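(* Let $\tau$ be a unital quantum channel on $\mathbb{M}_d$. Then the following statements are equivalent: (1) $\tau$ is eventually mixed twisted dephasing; (2) $\tau$ is eventually entanglement breaking; (3) $\tau$ is eventually PPT; (4) $\tau$ is eventually $2$-copositive; (5) there exists an integer $n_0\in\mathbb{N}$ such that $\mathrm{Range}(\tau^{n_0})\subseteq \mathcal{P}(\tau)'$; (6) $\bigcap_{n=1}^\infty \mathrm{Range}(\tau^n)\subseteq \mathcal{P}(\tau)'$; (7) all eigenvectors of $\tau$ corresponding to non-zero eigenvalues commute with all peripheral eigenvectors of $\tau$, that is, $\ker(\tau-\lambda\,\mathrm{id}_d)\subseteq\mathcal{P}(\tau)'$ for all $\lambda\neq 0$.
   Context: $\mathbb{M}_d$ is the algebra of $d\times d$ complex matrices, $\mathrm{id}_d$ the identity map on $\mathbb{M}_d$, $T$ the transpose map on $\mathbb{M}_d$, $\mathbb{U}(d)$ the unitary group in $\mathbb{M}_d$. A quantum channel (or channel) on $\mathbb{M}_d$ is a completely positive (CP), trace-preserving linear map; it is unital if $\tau(I_d)=I_d$. A linear map $\varphi$ on $\mathbb{M}_d$ is: $k$-copositive if $(\varphi\circ T)\otimes \mathrm{id}_k$ is positive; completely copositive if it is $k$-copositive for all $k\ge1$; PPT if it is CP and completely copositive; entanglement breaking (EB) if for every $k\ge 1$ and every positive semidefinite $Z\in\mathbb{M}_d\otimes\mathbb{M}_k$, $(\varphi\otimes\mathrm{id}_k)(Z)$ is separable, i.e. a finite sum of $X_j\otimes Y_j$ with $X_j,Y_j$ positive semidefinite.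 For $U\in\mathbb{M}_d$, $\mathrm{Ad}_U(X)=UXU^*$. The completely dephasing channel is $\Delta_d(X)=\sum_{j=1}^d\langle e_j,Xe_j\rangle|e_j\rangle\langle e_j|$, with $\{e_j\}$ the standard basis of $\mathbb{C}^d$. For $U,V\in\mathbb{U}(d)$, the twisted dephasing channel is $\beta_{U,V}=\mathrm{Ad}_U\circ\Delta_d\circ\mathrm{Ad}_{V^*}$. A mixed twisted dephasing (MTD) channel is a finite convex combination of twisted dephasing channels. For each of the properties MTD, EB, PPT, $2$-copositive, a linear map $\tau$ on $\mathbb{M}_d$ ''eventually'' has the property if there is $n_0\in\mathbb{N}$ such that $\tau^n$ has it for all $n\ge n_0$. A peripheral eigenvector of $\tau$ is an eigenvector for an eigenvalue of modulus $1$, and $\mathcal{P}(\tau)=\mathrm{span}\{X\in\mathbb{M}_d:\tau(X)=\lambda X\text{ for some }|\lambda|=1\}$ is the peripheral space. For $S\subseteq\mathbb{M}_d$, $S'$ denotes its commutant in $\mathbb{M}_d$. *)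

(* Defs.v *)
From HB Require Import structures.
From mathcomp Require Import all_boot all_order all_algebra.
From mathcomp Require Import boolp classical_sets reals.
From mathcomp Require Export complex mxtens.

Set Implicit Arguments.
Unset Strict Implicit.
Unset Printing Implicit Defensive.

Import Order.TTheory GRing.Theory Num.Theory.
Local Open Scope ring_scope.
Local Open Scope classical_set_scope.
Local Open Scope sesquilinear_scope.

(* In a numClosedFieldType, [0 <= z] says that z is real and nonnegative, so
   the quadratic form condition also forces A to be Hermitian. *)
Definition psdmx {C : numClosedFieldType} {n : nat} (A : 'M[C]_n) : Prop :=
  forall v : 'cV[C]_n, 0 <= (v ^t* *m A *m v) 0 0.

Definition positive_map {C : numClosedFieldType} {m n : nat}
    (f : 'M[C]_m -> 'M[C]_n) : Prop :=
  forall X, psdmx X -> psdmx (f X).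

(* M_d (x) M_k is identified with 'M_(d * k) through the Kronecker product *t:
   Z = \sum_(a, b) tblock a b Z *t delta_mx a b. *)
Definition tblock {C : numClosedFieldType} {d k : nat} (a b : 'I_k)
    (Z : 'M[C]_(d * k)) : 'M[C]_d :=
  \matrix_(i, j) Z (mxtens_index (i, a)) (mxtens_index (j, b)).

(* phi (x) id_k; see tens_idE. *)
Definition tens_id {C : numClosedFieldType} {d : nat} (k : nat)
    (phi : 'M[C]_d -> 'M[C]_d) (Z : 'M[C]_(d * k)) : 'M[C]_(d * k) :=
  \sum_(a < k) \sum_(b < k) phi (tblock a b Z) *t delta_mx a b.

Lemma tens_idE (C : numClosedFieldType) (d k : nat)
    (phi : {linear 'M[C]_d -> 'M[C]_d}) (X : 'M[C]_d) (Y : 'M[C]_k) :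
  tens_id phi (X *t Y) = phi X *t Y.
Proof.
apply/matrixP=> i j; case: (mxtens_indexP i)=> i0 a; case: (mxtens_indexP j)=> j0 b.
rewrite tensmxE /tens_id summxE (bigD1 a) //= [X in _ + X]big1 ?addr0; last first.
  move=> a' /negPf na; rewrite summxE big1 // => b' _.
  by rewrite tensmxE mxE eq_sym na mulr0.
rewrite summxE (bigD1 b) //= [X in _ + X]big1 ?addr0; last first.
  move=> b' /negPf nb; rewrite tensmxE mxE [b == _]eq_sym nb andbF mulr0 //.
rewrite tensmxE mxE !eqxx mulr1.
have -> : tblock a b (X *t Y) = Y a b *: X.
  by apply/matrixP=> p q; rewrite !mxE !mxtens_indexK mulrC.
by rewrite linearZ mxE mulrC.
Qed.

Definition completely_positive {C : numClosedFieldType} {d : nat}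
    (phi : 'M[C]_d -> 'M[C]_d) : Prop :=
  forall k, (1 <= k)%N -> positive_map (tens_id (k := k) phi).

Definition trace_preserving {C : numClosedFieldType} {d : nat}
    (phi : 'M[C]_d -> 'M[C]_d) : Prop :=
  forall X, \tr (phi X) = \tr X.

Definition quantum_channel {C : numClosedFieldType} {d : nat}
    (tau : {linear 'M[C]_d -> 'M[C]_d}) : Prop :=
  completely_positive tau /\ trace_preserving tau.

Definition unital {C : numClosedFieldType} {d : nat}
    (tau : 'M[C]_d -> 'M[C]_d) : Prop := tau 1%:M = 1%:M.

Definition copositive {C : numClosedFieldType} {d : nat} (k : nat)
    (phi : 'M[C]_d -> 'M[C]_d) : Prop :=
  positive_map (tens_id (k := k) (phi \o trmx)).

Definition completely_copositive {C : numClosedFieldType} {d : nat}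
    (phi : 'M[C]_d -> 'M[C]_d) : Prop :=
  forall k, (1 <= k)%N -> copositive k phi.

Definition PPT {C : numClosedFieldType} {d : nat}
    (phi : 'M[C]_d -> 'M[C]_d) : Prop :=
  completely_positive phi /\ completely_copositive phi.

Definition separable_mx {C : numClosedFieldType} {d k : nat}
    (Z : 'M[C]_(d * k)) : Prop :=
  exists (m : nat) (X : 'I_m -> 'M[C]_d) (Y : 'I_m -> 'M[C]_k),
    [/\ forall j, psdmx (X j), forall j, psdmx (Y j)
      & Z = \sum_(j < m) X j *t Y j].

Definition entanglement_breaking {C : numClosedFieldType} {d : nat}
    (phi : 'M[C]_d -> 'M[C]_d) : Prop :=
  forall k, (1 <= k)%N -> forall Z : 'M[C]_(d * k),
    psdmx Z -> separable_mx (tens_id phi Z).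

Definition Ad {C : numClosedFieldType} {d : nat} (U X : 'M[C]_d) : 'M[C]_d :=
  U *m X *m U ^t*.

Definition dephasing {C : numClosedFieldType} {d : nat} (X : 'M[C]_d) :
    'M[C]_d :=
  \sum_(j < d) X j j *: delta_mx j j.

Definition twisted_dephasing {C : numClosedFieldType} {d : nat}
    (U V : 'M[C]_d) : 'M[C]_d -> 'M[C]_d :=
  Ad U \o dephasing \o Ad (V ^t*).

Definition mixed_twisted_dephasing {C : numClosedFieldType} {d : nat}
    (phi : 'M[C]_d -> 'M[C]_d) : Prop :=
  exists (m : nat) (p : 'I_m -> C) (U V : 'I_m -> 'M[C]_d),
    [/\ forall i, 0 <= p i, \sum_(i < m) p i = 1,
        forall i, U i \is unitarymx, forall i, V i \is unitarymx
      & forall X, phi X = \sum_(i < m) p i *: twisted_dephasing (U i) (V i) X].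

Definition eventually_has {C : numClosedFieldType} {d : nat}
    (P : ('M[C]_d -> 'M[C]_d) -> Prop) (tau : 'M[C]_d -> 'M[C]_d) : Prop :=
  exists n0 : nat, forall n, (n0 <= n)%N -> P (iter n tau).

Definition linear_span {K : fieldType} {V : lmodType K} (S : set V) : set V :=
  [set x | exists (m : nat) (c : 'I_m -> K) (v : 'I_m -> V),
    (forall i, S (v i)) /\ x = \sum_(i < m) c i *: v i].

Definition peripheral_space {C : numClosedFieldType} {d : nat}
    (tau : 'M[C]_d -> 'M[C]_d) : set 'M[C]_d :=
  linear_span [set X | exists lambda : C, `|lambda| = 1 /\ tau X = lambda *: X].

Definition commutant {C : numClosedFieldType} {d : nat} (S : set 'M[C]_d) :
    set 'M[C]_d :=
  [set X | forall Y, S Y -> X *m Y = Y *m X].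

(* ker (tau - lambda id) *)
Definition eigenker {C : numClosedFieldType} {d : nat}
    (tau : 'M[C]_d -> 'M[C]_d) (lambda : C) : set 'M[C]_d :=
  [set X | tau X - lambda *: X = 0].

(* Main.v *)
Require Import Defs.
From HB Require Import structures.
From mathcomp Require Import all_boot all_order all_fingroup all_algebra.
From mathcomp Require Import boolp classical_sets reals complex.
From mathcomp Require Import ring.

Set Implicit Arguments.
Unset Strict Implicit.
Unset Printing Implicit Defensive.

Import Order.TTheory GRing.Theory Num.Theory.
Local Open Scope ring_scope.
Local Open Scope classical_set_scope.

(* The implications from (1) to (4) are formal: a dephasing channel outputs
   separable matrices, and partial transposition preserves separability.

   (4) => (5): a 2-positive unital map phi satisfies the Kadison-Schwarz
   inequality phi(A^* A) >= phi(A)^* phi(A), and equality at A makes phi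
   multiplicative at A.  Trace preservation forces equality for phi = tau^n at a
   peripheral eigenvector Y.  If tau^n is 2-copositive, then tau^n o T is a
   Schwarz map as well, so that tau^n is also anti-multiplicative at Y, and
   tau^n(X) commutes with Y.

   (7) => (1): if [X, Y] is an eigenvector for a nonzero eigenvalue, where Y is
   peripheral, then it commutes with Y^*, hence is trace-orthogonal to itself
   and vanishes; so tau is nilpotent on the space of all [X, Y], and tau^n(X)
   commutes with Y for large n.  On the orthogonal complement of the peripheral
   space, tau has spectral radius < 1 and its powers tend to 0.  The peripheral
   space is a commutative algebra, spanned by orthogonal projections p_c after
   a unitary change of basis; so, up to a permutation unitary, tau^n fixes each
   p_c, kills the off-diagonal blocks, and tends to the block-depolarizing map
   Omega.  Finally Omega is interior to the cone spanned by the twisted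
   dephasing channels: Omega is the average of U P_s Delta(V^* . V) P_s^* U^*
   over the block-preserving permutations s, for all block-diagonal unitaries U
   and V, and the differences of two such terms span all the directions
   X |-> tr(B X) A with A, B Hermitian and traceless in one block. *)

(** * Adjoints and positive semidefinite matrices *)

Section Adjoint.
Local Open Scope sesquilinear_scope.
Variable C : numClosedFieldType.

Lemma dagE m n (A : 'M[C]_(m, n)) i j : (A ^t*) i j = (A j i)^*.
Proof. by rewrite !mxE. Qed.

Lemma dagM m n p (A : 'M[C]_(m, n)) (B : 'M[C]_(n, p)) :
  (A *m B) ^t* = B ^t* *m A ^t*.
Proof. by rewrite trmx_mul map_mxM. Qed.

Lemma dagD m n (A B : 'M[C]_(m, n)) : (A + B) ^t* = A ^t* + B ^t*.
Proof. by rewrite linearD /= map_mxD. Qed.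

Lemma dagB m n (A B : 'M[C]_(m, n)) : (A - B) ^t* = A ^t* - B ^t*.
Proof. by rewrite linearB /= map_mxB. Qed.

Lemma dagN m n (A : 'M[C]_(m, n)) : (- A) ^t* = - A ^t*.
Proof. by rewrite linearN /= map_mxN. Qed.

Lemma dagZ m n (z : C) (A : 'M[C]_(m, n)) : (z *: A) ^t* = z^* *: A ^t*.
Proof. by rewrite linearZ /= map_mxZ. Qed.

Lemma dag1 n : (1%:M : 'M[C]_n) ^t* = 1%:M.
Proof. by rewrite trmx1 map_mx1. Qed.

Lemma dag_delta m n (i : 'I_m) (j : 'I_n) :
  (delta_mx i j : 'M[C]_(m, n)) ^t* = delta_mx j i.
Proof. by rewrite trmx_delta map_delta_mx. Qed.

Lemma dag_tens m n p q (A : 'M[C]_(m, n)) (B : 'M[C]_(p, q)) :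
  (A *t B) ^t* = A ^t* *t B ^t*.
Proof. by rewrite trmx_tens map_mxT. Qed.

Lemma mxtrace_dag n (A : 'M[C]_n) : \tr (A ^t*) = (\tr A)^*.
Proof. by rewrite /mxtrace rmorph_sum; apply: eq_bigr => i _; rewrite dagE. Qed.

Lemma mxtrace_gram n p (A : 'M[C]_(n, p)) :
  \tr (A ^t* *m A) = \sum_i \sum_j `|A j i| ^+ 2.
Proof.
rewrite /mxtrace; apply: eq_bigr => i _; rewrite mxE; apply: eq_bigr => j _.
by rewrite dagE mulrC normCK.
Qed.

Lemma mxtrace_gram_ge0 n p (A : 'M[C]_(n, p)) : 0 <= \tr (A ^t* *m A).
Proof.
by rewrite mxtrace_gram; do 2!apply: sumr_ge0 => ? _; rewrite exprn_ge0.
Qed.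

Lemma mxtrace_gram_eq0 n p (A : 'M[C]_(n, p)) : \tr (A ^t* *m A) = 0 -> A = 0.
Proof.
rewrite mxtrace_gram => /eqP.
rewrite psumr_eq0 => [/allP h|i _]; last by apply: sumr_ge0 => j _; rewrite exprn_ge0.
apply/matrixP => i j; move: (h j); rewrite mem_index_enum => /(_ isT) /=.
rewrite psumr_eq0 => [/allP/(_ i)|k _]; last by rewrite exprn_ge0.
by rewrite mem_index_enum => /(_ isT); rewrite /= expf_eq0 /= normr_eq0 mxE => /eqP.
Qed.

Lemma unitarymx_dagl n (U : 'M[C]_n) : U \is unitarymx -> U ^t* *m U = 1%:M.
Proof. by rewrite -trmxC_unitary => /unitarymxP; rewrite trmxCK. Qed.

End Adjoint.

Section Psd.
Local Open Scope sesquilinear_scope.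
Variable C : numClosedFieldType.

Definition sform n (A : 'M[C]_n) (x y : 'cV[C]_n) : C := (x ^t* *m A *m y) 0 0.

Lemma sformDl n (A : 'M[C]_n) x x' y : sform A (x + x') y = sform A x y + sform A x' y.
Proof. by rewrite /sform dagD !mulmxDl mxE. Qed.

Lemma sformDr n (A : 'M[C]_n) x y y' : sform A x (y + y') = sform A x y + sform A x y'.
Proof. by rewrite /sform mulmxDr mxE. Qed.

Lemma sformZl n (A : 'M[C]_n) z x y : sform A (z *: x) y = z^* * sform A x y.
Proof. by rewrite /sform dagZ -!scalemxAl mxE. Qed.

Lemma sformZr n (A : 'M[C]_n) z x y : sform A x (z *: y) = z * sform A x y.
Proof. by rewrite /sform -scalemxAr mxE. Qed.

Lemma sformDm n (A B : 'M[C]_n) x y : sform (A + B) x y = sform A x y + sform B x y.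
Proof. by rewrite /sform mulmxDr mulmxDl mxE. Qed.

Lemma sformZm n z (A : 'M[C]_n) x y : sform (z *: A) x y = z * sform A x y.
Proof. by rewrite /sform -scalemxAr -scalemxAl mxE. Qed.

Lemma sform_delta n (A : 'M[C]_n) i j :
  sform A (delta_mx i 0) (delta_mx j 0) = A i j.
Proof. by rewrite /sform dag_delta -rowE -colE !mxE. Qed.

(** Polarization: the values at x + y and x + i y give the sum and the difference of [sform A x y]
    and [sform A y x]. *)
Lemma sform_eq0 n (A : 'M[C]_n) : (forall v, sform A v v = 0) -> A = 0.
Proof.
move=> h; apply/matrixP => i j; rewrite -sform_delta mxE.
set x := delta_mx i 0; set y := delta_mx j 0.
have h1 := h (x + y); have hi := h (x + 'i *: y).
rewrite !(sformDl, sformDr) !(sformZl, sformZr) !h !(mulr0, addr0, add0r) in h1 hi.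
rewrite conjCi mulNr -mulrBr in hi.
move/eqP: hi; rewrite mulf_eq0 (negPf (neq0Ci _)) /= subr_eq0 => /eqP hi.
move/eqP: h1; rewrite addrC -hi -mulr2n mulrn_eq0 /= => /eqP; exact.
Qed.

Lemma sform_dag n (A : 'M[C]_n) x y : sform (A ^t*) x y = (sform A y x)^*.
Proof. by rewrite /sform -dagE !dagM trmxCK mulmxA. Qed.

(** The quadratic form of A is real, so that of [A ^t* - A] vanishes identically. *)
Lemma psdmx_herm n (A : 'M[C]_n) : psdmx A -> A ^t* = A.
Proof.
move=> hA; apply/eqP; rewrite -subr_eq0; apply/eqP/sform_eq0 => v.
have: (sform A v v)^* = sform A v v by apply/CrealP/ger0_real/hA.
rewrite -sform_dag /sform mulmxBr mulmxBl !mxE => ->; exact: subrr.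
Qed.

Lemma psdmx_gram m n (B : 'M[C]_(m, n)) : psdmx (B ^t* *m B).
Proof.
move=> v; have := mxtrace_gram_ge0 (B *m v).
by rewrite /mxtrace big_ord1 dagM !mulmxA.
Qed.

Lemma psdmx_congr m n (A : 'M[C]_m) (B : 'M[C]_(m, n)) :
  psdmx A -> psdmx (B ^t* *m A *m B).
Proof. by move=> hA v; rewrite !mulmxA -dagM -mulmxA. Qed.

Lemma psdmx0 n : psdmx (0 : 'M[C]_n).
Proof. by move=> v; rewrite mulmx0 mul0mx mxE. Qed.

Lemma psdmxD n (A B : 'M[C]_n) : psdmx A -> psdmx B -> psdmx (A + B).
Proof. by move=> hA hB v; rewrite mulmxDr mulmxDl mxE addr_ge0. Qed.

Lemma psdmx_sum n (I : Type) (r : seq I) (F : I -> 'M[C]_n) :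
  (forall i, psdmx (F i)) -> psdmx (\sum_(i <- r) F i).
Proof.
by move=> hF; elim/big_ind: _ => [|A B hA hB|i _]; [exact: psdmx0|exact: psdmxD|].
Qed.

Lemma psdmxZ n (z : C) (A : 'M[C]_n) : 0 <= z -> psdmx A -> psdmx (z *: A).
Proof. by move=> hz hA v; rewrite -scalemxAr -scalemxAl mxE mulr_ge0. Qed.

Lemma hermitian_diag n (A : 'M[C]_n) : A ^t* = A ->
  exists2 U : 'M[C]_n, U \is unitarymx & exists2 a : 'rV[C]_n,
    (forall i, a 0 i \is Num.real) & A = U ^t* *m diag_mx a *m U.
Proof.
move=> hA; have hh : A \is hermsymmx.
  by apply/is_hermitianmxP; rewrite expr0 scale1r hA.
exists (spectralmx A); first exact: spectral_unitarymx.
exists (spectral_diag A) => [i|].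
  exact: (mxOverP (hermitian_spectral_diag_real hh)).
rewrite -invmx_unitary ?spectral_unitarymx //.
exact/orthomx_spectralP/hermitian_normalmx.
Qed.

Lemma psdmx_gramP n (A : 'M[C]_n) : psdmx A -> exists B : 'M_n, A = B ^t* *m B.
Proof.
move=> hA; have [U hU [a _ eA]] := hermitian_diag (psdmx_herm hA).
exists (diag_mx (map_mx sqrtC a) *m U).
have ha i : 0 <= a 0 i.
  (* The form at the i-th eigenvector U^* e_i is the i-th eigenvalue. *)
  have := hA (U ^t* *m delta_mx i 0); rewrite dagM trmxCK eA.
  rewrite !mulmxA -[_ *m U *m U ^t*]mulmxA (unitarymxP hU) mulmx1.
  rewrite -[_ *m U *m U ^t*]mulmxA (unitarymxP hU) mulmx1.
  by rewrite dag_delta -rowE -colE !mxE eqxx.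
suff eD : diag_mx a = (diag_mx (map_mx sqrtC a)) ^t* *m diag_mx (map_mx sqrtC a).
  by rewrite eA dagM eD !mulmxA.
rewrite tr_diag_mx map_diag_mx mulmx_diag; congr diag_mx.
apply/rowP => i; rewrite !mxE -[RHS]/((sqrtC (a 0 i))^* * sqrtC (a 0 i)).
by rewrite geC0_conj ?sqrtC_ge0 // -expr2 sqrtCK.
Qed.

Lemma psdmx_tr0 n (A : 'M[C]_n) : psdmx A -> \tr A = 0 -> A = 0.
Proof.
by move=> /psdmx_gramP[B ->] /mxtrace_gram_eq0 ->; rewrite mulmx0.
Qed.

Lemma psdmx_tens m n (A : 'M[C]_m) (B : 'M[C]_n) :
  psdmx A -> psdmx B -> psdmx (A *t B).
Proof.
move=> /psdmx_gramP[A' ->] /psdmx_gramP[B' ->].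
rewrite -tensmx_mul -dag_tens; exact: psdmx_gram.
Qed.

Lemma psdmx_trmx n (A : 'M[C]_n) : psdmx A -> psdmx A^T.
Proof.
move=> /psdmx_gramP[B ->]; rewrite trmx_mul.
have -> : (B ^t*)^T = (B^T) ^t* by rewrite map_trmx.
by rewrite -{1}[B^T]trmxCK; apply: psdmx_gram.
Qed.

End Psd.

(** * Separability and the Kadison-Schwarz inequality *)

Section TensorId.
Local Open Scope sesquilinear_scope.
Variable C : numClosedFieldType.

Lemma tens_matrixP (m n : nat) (A B : 'M[C]_(m * n)) :
  (forall i a j b, A (mxtens_index (i, a)) (mxtens_index (j, b)) =
                   B (mxtens_index (i, a)) (mxtens_index (j, b))) -> A = B.
Proof.
move=> h; apply/matrixP=> i j.
by case: (mxtens_indexP i)=> i0 a; case: (mxtens_indexP j)=> j0 b.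
Qed.

Lemma tens_id_index d k (phi : 'M[C]_d -> 'M[C]_d) (Z : 'M[C]_(d * k)) i a j b :
  tens_id phi Z (mxtens_index (i, a)) (mxtens_index (j, b)) =
  phi (tblock a b Z) i j.
Proof.
rewrite /tens_id summxE (bigD1 a) //= [X in _ + X]big1 ?addr0; last first.
  move=> a' /negPf na; rewrite summxE big1 // => b' _.
  by rewrite tensmxE mxE eq_sym na mulr0.
rewrite summxE (bigD1 b) //= [X in _ + X]big1 ?addr0; last first.
  by move=> b' /negPf nb; rewrite tensmxE mxE [b == _]eq_sym nb andbF mulr0.
by rewrite tensmxE mxE !eqxx mulr1.
Qed.

Lemma sum_mxtens_index m n (F : 'I_(m * n) -> C) :
  \sum_s F s = \sum_a \sum_i F (mxtens_index (i, a)).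
Proof.
rewrite (reindex (@mxtens_index m n)) /=; last first.
  by exists (@mxtens_unindex m n) => x _; rewrite (mxtens_indexK, mxtens_unindexK).
by rewrite exchange_big pair_bigA; apply: eq_bigr => -[].
Qed.

(** The double sum is the quadratic form of Z at the vector obtained by summing the u_a (x) e_a. *)
Lemma psdmx_block_form d k (Z : 'M[C]_(d * k)) (u : 'I_k -> 'cV[C]_d) :
  psdmx Z -> 0 <= \sum_a \sum_b sform (tblock a b Z) (u a) (u b).
Proof.
pose w : 'cV[C]_(d * k) :=
  \col_s u (mxtens_unindex s).2 (mxtens_unindex s).1 0.
have wE i a : w (mxtens_index (i, a)) 0 = u a i 0 by rewrite mxE mxtens_indexK.
move=> /(_ w); congr (0 <= _); rewrite mxE sum_mxtens_index exchange_big /=.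
rewrite [RHS]exchange_big [LHS]exchange_big; apply: eq_bigr => b _ /=.
rewrite /sform; under [RHS]eq_bigr do rewrite mxE.
rewrite [RHS]exchange_big; apply: eq_bigr => j _ /=.
rewrite wE -mulr_suml mxE sum_mxtens_index; congr (_ * _).
apply: eq_bigr => a _; rewrite mxE; apply: eq_bigr => i _.
by rewrite !dagE wE mxE.
Qed.

(** This matrix is the compression of Z by v on the first tensor factor; take u_a = w_a v in the
    block form. *)
Lemma psdmx_partial_form d k (Z : 'M[C]_(d * k)) (v : 'cV[C]_d) :
  psdmx Z -> psdmx (\matrix_(a, b) sform (tblock a b Z) v v).
Proof.
move=> hZ w; have := psdmx_block_form (fun a => w a 0 *: v) hZ; congr (0 <= _).
rewrite mxE exchange_big; apply: eq_bigr => b _ /=.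
rewrite mxE mulr_suml; apply: eq_bigr => a _.
by rewrite sformZl sformZr dagE mxE; ring.
Qed.

Lemma separable_finType d k (J : finType) (X : J -> 'M[C]_d) (Y : J -> 'M[C]_k) :
  (forall j, psdmx (X j)) -> (forall j, psdmx (Y j)) ->
  separable_mx (\sum_j X j *t Y j).
Proof.
move=> hX hY; exists #|J|, (fun i => X (enum_val i)), (fun i => Y (enum_val i)).
by split=> //; rewrite big_enum_val.
Qed.

Lemma separable_psd d k (Z : 'M[C]_(d * k)) : separable_mx Z -> psdmx Z.
Proof.
move=> [m [X [Y [hX hY ->]]]]; apply: psdmx_sum => j; exact: psdmx_tens.
Qed.

Lemma AdE d (U X : 'M[C]_d) j :
  Ad (U ^t*) X j j = sform X (col j U) (col j U).
Proof.
rewrite /Ad /sform trmxCK !colE -[delta_mx j 0 in RHS]/(delta_mx j 0).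
by rewrite dagM dag_delta !mulmxA -colE -!mulmxA -rowE !mxE.
Qed.

Lemma twisted_dephasingE d (U V X : 'M[C]_d) :
  twisted_dephasing U V X =
  \sum_(j < d) sform X (col j V) (col j V) *: (U *m delta_mx j j *m U ^t*).
Proof.
rewrite /twisted_dephasing /= /dephasing /Ad mulmx_sumr mulmx_suml.
by apply: eq_bigr => j _; rewrite -AdE -scalemxAr -scalemxAl.
Qed.

Lemma psdmx_conj_delta d (U : 'M[C]_d) j : psdmx (U *m delta_mx j j *m U ^t*).
Proof.
have := psdmx_gram ((U *m delta_mx j (0 : 'I_1)) ^t*).
by rewrite trmxCK dagM dag_delta mulmxA -[U *m _ *m _]mulmxA mul_delta_mx.
Qed.

(** A twisted dephasing channel measures along the columns of V and prepares the projections onto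
    the columns of U. On the first factor of Z it gives a sum of these projections tensored with
    compressions of Z. *)
Lemma MTD_EB d (phi : 'M[C]_d -> 'M[C]_d) :
  mixed_twisted_dephasing phi -> entanglement_breaking phi.
Proof.
move=> [m [p [U [V [hp _ _ _ hphi]]]]] k _ Z hZ.
pose X (ij : 'I_m * 'I_d) := p ij.1 *:
   (U ij.1 *m delta_mx ij.2 ij.2 *m (U ij.1) ^t*).
pose Y (ij : 'I_m * 'I_d) := \matrix_(a < k, b < k)
   sform (tblock a b Z) (col ij.2 (V ij.1)) (col ij.2 (V ij.1)).
have -> : tens_id phi Z = \sum_ij X ij *t Y ij.
  apply: tens_matrixP => i a j b; rewrite tens_id_index hphi !summxE.
  rewrite -(pair_bigA _ (fun i0 j0 => (X (i0, j0) *t Y (i0, j0))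
    (mxtens_index (i, a)) (mxtens_index (j, b)))).
  apply: eq_bigr => s _; rewrite twisted_dephasingE scaler_sumr summxE.
  apply: eq_bigr => t _; rewrite tensmxE [Y _ _ _]mxE /X /=.
  rewrite scalerA mulrC -scalerA [RHS]mulrC; exact: mxE.
apply: separable_finType => -[i j].
  exact/psdmxZ/psdmx_conj_delta.
exact: psdmx_partial_form.
Qed.

(** Once Z is replaced by its full transpose, transposing the input of [phi] amounts to transposing
    the second tensor factor of the output. *)
Lemma tens_id_transpose_index d k (phi : 'M[C]_d -> 'M[C]_d)
    (Z : 'M[C]_(d * k)) i a j b :
  tens_id (phi \o trmx) Z (mxtens_index (i, a)) (mxtens_index (j, b)) =
  tens_id phi Z^T (mxtens_index (i, b)) (mxtens_index (j, a)).
Proof.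
rewrite !tens_id_index /=; congr (phi _ _ _).
by apply/matrixP => p q; rewrite !mxE.
Qed.

Lemma EB_PPT d (phi : 'M[C]_d -> 'M[C]_d) :
  entanglement_breaking phi -> PPT phi.
Proof.
move=> h; split=> k hk Z hZ; first exact/separable_psd/h.
have [m [X [Y [hX hY e]]]] := h k hk _ (psdmx_trmx hZ).
suff -> : tens_id (phi \o trmx) Z = \sum_(s < m) X s *t (Y s)^T.
  by apply: psdmx_sum => s; apply: psdmx_tens => //; apply: psdmx_trmx.
apply: tens_matrixP => i a j b; rewrite tens_id_transpose_index e !summxE.
by apply: eq_bigr => s _; rewrite !tensmxE mxE.
Qed.

Lemma PPT_copositive d k (phi : 'M[C]_d -> 'M[C]_d) :
  (1 <= k)%N -> PPT phi -> copositive k phi.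
Proof. by move=> hk [_ h]; apply: h. Qed.

Lemma eventually_has_impl d (P Q : ('M[C]_d -> 'M[C]_d) -> Prop) tau :
  (forall phi, P phi -> Q phi) -> eventually_has P tau -> eventually_has Q tau.
Proof. by move=> h [n0 hn0]; exists n0 => n /hn0/h. Qed.

End TensorId.

Section KadisonSchwarz.
Local Open Scope sesquilinear_scope.
Variables (C : numClosedFieldType) (d : nat).
Implicit Types (phi : {linear 'M[C]_d -> 'M[C]_d}) (A B X Y : 'M[C]_d).

(** Adjoint preservation and the Kadison-Schwarz inequality are the only consequences of
    2-positivity used later on. *)
Definition schwarz_map (phi : 'M[C]_d -> 'M[C]_d) : Prop := forall A,
  phi (A ^t*) = (phi A) ^t* /\
  psdmx (phi (A ^t* *m A) - (phi A) ^t* *m phi A).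

Lemma tens_idD k phi (Z W : 'M[C]_(d * k)) :
  tens_id phi (Z + W) = tens_id phi Z + tens_id phi W.
Proof.
apply: tens_matrixP => i a j b; rewrite [RHS]mxE !tens_id_index.
have -> : tblock a b (Z + W) = tblock a b Z + tblock a b W.
  by apply/matrixP => p q; rewrite !mxE.
by rewrite linearD mxE.
Qed.

Lemma tblockD k a b (Z W : 'M[C]_(d * k)) :
  tblock a b (Z + W) = tblock a b Z + tblock a b W.
Proof. by apply/matrixP => p q; rewrite !mxE. Qed.

Lemma tblock_tens k a b X (Y : 'M[C]_k) : tblock a b (X *t Y) = Y a b *: X.
Proof. by apply/matrixP=> p q; rewrite !mxE !mxtens_indexK mulrC. Qed.

(** The Gram matrix of N has the block rows (1, A) and (A^*, A^* A). Its image under [phi] is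
    positive with upper left block 1, and the inequality says that the Schur complement of that
    block is positive. *)
Lemma two_positive_schwarz phi :
  positive_map (tens_id (k := 2) phi) -> unital phi -> schwarz_map phi.
Proof.
move=> hphi h1.
move=> A; pose i0 : 'I_2 := 0; pose i1 : 'I_2 := 1.
pose N : 'M[C]_(d * 2) := 1%:M *t delta_mx i0 i0 + A *t delta_mx i0 i1.
have hpsd := hphi _ (psdmx_gram N).
have eN : N ^t* *m N =
    1%:M *t delta_mx i0 i0 + A *t delta_mx i0 i1 +
    (A ^t* *t delta_mx i1 i0 + (A ^t* *m A) *t delta_mx i1 i1).
  rewrite /N dagD !dag_tens !dag_delta dag1 mulmxDl !mulmxDr.
  by rewrite !tensmx_mul !mul_delta_mx !mul1mx !mulmx1.
rewrite eN !tens_idD !tens_idE h1 in hpsd; set M := (X in psdmx X) in hpsd.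
have e00 : tblock i0 i0 M = 1%:M.
  by rewrite !tblockD !tblock_tens !mxE !scale0r !addr0 scale1r.
have e01 : tblock i0 i1 M = phi A.
  by rewrite !tblockD !tblock_tens !mxE !scale0r !addr0 add0r scale1r.
have e10 : tblock i1 i0 M = phi (A ^t*).
  by rewrite !tblockD !tblock_tens !mxE !scale0r !addr0 add0r scale1r.
have e11 : tblock i1 i1 M = phi (A ^t* *m A).
  by rewrite !tblockD !tblock_tens !mxE !scale0r !add0r scale1r.
have hs : phi (A ^t*) = (phi A) ^t*.
  rewrite -e10 -{1}(psdmx_herm hpsd) -e01.
  by apply/matrixP => i j; rewrite !mxE.
(* The block vector (- phi A v, v) turns the block form into the Schur complement at v. *)
split=> // v; have := psdmx_block_form
  (fun a => if a == i0 then - (phi A *m v) else v) hpsd.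
have l0 : lift ord0 ord0 = i1 by apply/val_inj.
rewrite !big_ord_recl !big_ord0 !addr0 /= !l0 -![ord0]/i0.
rewrite e00 e01 e10 e11 hs; congr (0 <= _).
rewrite /sform !dagN !dagM !(mulNmx, mulmxN) mulmx1 opprK.
rewrite mulmxBr mulmxBl !mulmxA.
have hN (X : 'M[C]_1) : (- X) 0 0 = - X 0 0 by rewrite mxE.
by rewrite [RHS]mxE !hN addrA subrr add0r addrC.
Qed.

End KadisonSchwarz.

(** * Multiplicativity at peripheral eigenvectors *)

Section IterLinear.
Local Open Scope sesquilinear_scope.
Variables (K : pzRingType) (V : lmodType K) (f : {linear V -> V}).

Lemma iter_is_linear n : linear (iter n f).
Proof. by elim: n => [//|n IH] a x y; rewrite !iterS IH linearP. Qed.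

HB.instance Definition _ n :=
  GRing.isLinear.Build K V V *:%R (iter n f) (iter_is_linear n).

Lemma iter_eigen n (l : K) x : f x = l *: x -> iter n f x = l ^+ n *: x.
Proof.
move=> h; elim: n => [|n IH]; first by rewrite scale1r.
by rewrite iterS IH linearZ /= h scalerA -exprSr.
Qed.

End IterLinear.

Section Schwarz.
Local Open Scope sesquilinear_scope.
Variables (C : numClosedFieldType) (d : nat).
Implicit Types (phi : {linear 'M[C]_d -> 'M[C]_d}) (A B X Y : 'M[C]_d).

(** If w were nonzero, z = - (q + 1) / w^* would give the negative value - (q + 2). *)
Lemma quadratic_ge0_linear0 (w q : C) :
  (forall z, 0 <= z^* * w + z * w^* + q) -> w = 0.
Proof.
move=> h; have q0 : 0 <= q by have := h 0; rewrite conjC0 !mul0r !add0r.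
apply: contraTeq isT => w0; have := h (- (q + 1) / w^*).
have -> : (- (q + 1) / w^*)^* = - (q + 1) / w.
  rewrite fmorph_div /= conjCK; congr (_ / _).
  by apply/CrealP; rewrite rpredN rpredD ?rpred1 ?ger0_real.
rewrite mulfVK // mulfVK ?conjC_eq0 //.
have -> : - (q + 1) + - (q + 1) + q = - (q + 2) by ring.
by rewrite oppr_ge0 lt_geF // ltr_wpDl.
Qed.

(* Cauchy-Schwarz for the positive matrix-valued form
   (X, Y) |-> phi (X^* Y) - phi X^* phi Y. *)
Lemma schwarz_multiplicative phi A : schwarz_map phi ->
  phi (A ^t* *m A) = (phi A) ^t* *m phi A ->
  forall B, phi (A ^t* *m B) = (phi A) ^t* *m phi B.
Proof.
move=> hS hA B.
pose D X Y := phi (X ^t* *m Y) - (phi X) ^t* *m phi Y.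
have hD X Y : (D X Y) ^t* = D Y X.
  rewrite /D dagB dagM trmxCK -(proj1 (hS _)) dagM trmxCK; congr (_ - _).
suff /eqP : D A B = 0 by rewrite subr_eq0 => /eqP.
apply: sform_eq0 => v.
apply: (@quadratic_ge0_linear0 _ (sform (D B B) v v)) => z.
(* In the Schwarz inequality at z A + B, the term in |z|^2 is D A A, which vanishes by
   hypothesis. *)
have := (proj2 (hS (z *: A + B))) v; congr (0 <= _).
rewrite -[LHS]/(sform _ v v) -sform_dag hD.
have -> : phi ((z *: A + B) ^t* *m (z *: A + B))
    - phi (z *: A + B) ^t* *m phi (z *: A + B) =
    z^* *: D A B + z *: D B A + D B B.
  rewrite /D (linearP phi) !(dagD, dagZ, mulmxDl, mulmxDr).
  rewrite -!scalemxAl -!scalemxAr !linearD !linearZ /= hA.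
  move: (phi A ^t* *m phi A) (phi A ^t* *m phi B) (phi B ^t* *m phi A)
    (phi B ^t* *m phi B) (phi (A ^t* *m B)) (phi (B ^t* *m A))
    (phi (B ^t* *m B)) => *.
  by apply/matrixP => i j; rewrite !mxE; ring.
by rewrite /D !(sformDm, sformZm).
Qed.

Lemma schwarz_transpose phi :
  positive_map (tens_id (k := 2) (phi \o trmx)) -> unital phi ->
  schwarz_map (phi \o trmx).
Proof.
move=> h h1; have e : (phi \o trmx) 1%:M = 1%:M by rewrite /= trmx1.
exact: (@two_positive_schwarz _ _ (phi \o trmx)).
Qed.

End Schwarz.

(** * Peripheral eigenvectors of a trace-preserving Schwarz map *)

Section Peripheral.
Local Open Scope sesquilinear_scope.
Variables (C : numClosedFieldType) (d : nat) (tau : {linear 'M[C]_d -> 'M[C]_d}).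
Hypotheses (hS : schwarz_map tau) (hT : trace_preserving tau) (h1 : unital tau).
Implicit Types X Y : 'M[C]_d.

(** These are the generators of [peripheral_space], zero included; having the same commutant, they
    replace the span everywhere below. *)
Definition peripheral (f : 'M[C]_d -> 'M[C]_d) Y :=
  exists l : C, `|l| = 1 /\ f Y = l *: Y.

(** As |l| = 1, the Schwarz defect at Y is tau (Y^* Y) - Y^* Y. It is positive, and trace
    preservation makes its trace zero. *)
Lemma peripheral_gram Y : peripheral tau Y ->
  tau (Y ^t* *m Y) = Y ^t* *m Y /\ tau Y ^t* *m tau Y = Y ^t* *m Y.
Proof.
move=> [l [hl e]].
have e2 : tau Y ^t* *m tau Y = Y ^t* *m Y.
  rewrite e dagZ -scalemxAl -scalemxAr scalerA mulrC -normCK hl.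
  by rewrite expr1n scale1r.
split=> //; apply/eqP; rewrite -subr_eq0 -[X in _ - X]e2; apply/eqP.
apply: psdmx_tr0; first exact: (proj2 (hS Y)).
by rewrite linearB /= hT e2 subrr.
Qed.

Lemma peripheral_dag Y : peripheral tau Y -> peripheral tau (Y ^t*).
Proof.
by move=> [l [hl e]]; exists l^*; rewrite norm_conjC (proj1 (hS _)) e dagZ.
Qed.

Lemma peripheral_mull Y X : peripheral tau Y ->
  tau (Y *m X) = tau Y *m tau X.
Proof.
move=> /peripheral_dag h; have [e e'] := peripheral_gram h.
rewrite -{1}[Y]trmxCK (schwarz_multiplicative hS) ?e ?e' //.
by rewrite (proj1 (hS _)) trmxCK.
Qed.

Lemma peripheral_mulr Y X : peripheral tau Y ->
  tau (X *m Y) = tau X *m tau Y.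
Proof.
move=> /peripheral_dag h; rewrite -[X *m Y]trmxCK (proj1 (hS _)) dagM.
by rewrite peripheral_mull // dagM -!(proj1 (hS _)) !trmxCK.
Qed.

Lemma iter_dag n X : iter n tau (X ^t*) = (iter n tau X) ^t*.
Proof. by elim: n => //= n ->; rewrite (proj1 (hS _)). Qed.

Lemma iter_trace n X : \tr (iter n tau X) = \tr X.
Proof. by elim: n => //= n IH; rewrite hT. Qed.

Lemma iter_unital n : iter n tau 1%:M = 1%:M.
Proof. by elim: n => //= n ->. Qed.

Lemma peripheral_iter n Y : peripheral tau Y -> peripheral tau (iter n tau Y).
Proof.
move=> [l [hl e]]; exists l; rewrite hl; split=> //.
by rewrite (iter_eigen n e) linearZ /= e !scalerA mulrC.
Qed.

Lemma iter_peripheral_mull n Y X : peripheral tau Y ->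
  iter n tau (Y *m X) = iter n tau Y *m iter n tau X.
Proof.
move=> h; elim: n => //= n ->; rewrite peripheral_mull //.
exact: peripheral_iter.
Qed.

Lemma iter_peripheral_mulr n Y X : peripheral tau Y ->
  iter n tau (X *m Y) = iter n tau X *m iter n tau Y.
Proof.
move=> h; elim: n => //= n ->; rewrite peripheral_mulr //.
exact: peripheral_iter.
Qed.

Lemma copositive_commute n X Y : copositive 2 (iter n tau) ->
  peripheral tau Y -> iter n tau X *m Y = Y *m iter n tau X.
Proof.
move=> hc; wlog suff aux : Y / peripheral tau Y ->
    iter n tau X *m Y ^t* = Y ^t* *m iter n tau X.
  by move=> /peripheral_dag/aux; rewrite trmxCK.
move=> hY; set phi := iter n tau.
have hpsi : schwarz_map (phi \o trmx).
  by apply: (@schwarz_transpose _ _ (iter n tau)) => //; exact: iter_unital.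
have [l [hl e]] := hY.
have ePhi : phi Y = l ^+ n *: Y by exact: iter_eigen.
have l0 : l ^+ n != 0 by rewrite expf_neq0 // -normr_eq0 hl oner_neq0.
have hYs := peripheral_dag hY.
have fixg Z : peripheral tau Z -> phi (Z ^t* *m Z) = Z ^t* *m Z.
  by rewrite /phi => /peripheral_gram[eZ _]; elim: (n) => //= m ->.
have gr : phi Y ^t* *m phi Y = Y ^t* *m Y.
  rewrite ePhi dagZ -scalemxAl -scalemxAr scalerA mulrC -normCK normrX hl.
  by rewrite !expr1n scale1r.
have eT : (Y^T) ^t* *m Y^T = (Y *m Y ^t*)^T.
  by rewrite trmx_mul; congr (_ *m _); apply/matrixP => i j; rewrite !mxE.
(* The Schwarz inequality of [phi \o trmx] at Y^T reads Y Y^* >= Y^* Y. The traces agree, so Y is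
   normal, and the inequality is an equality. *)
have nrm : Y *m Y ^t* = Y ^t* *m Y.
  apply/eqP; rewrite -subr_eq0; apply/eqP/psdmx_tr0.
    have := proj2 (hpsi Y^T); rewrite eT /= !trmxK gr.
    by have := fixg _ hYs; rewrite trmxCK => ->.
  by rewrite linearB /= mxtrace_mulC subrr.
(* Equality puts Y^T in the multiplicative domain of [phi \o trmx], and the transposition reverses
   products. *)
have anti : phi (X *m Y ^t*) = phi (Y ^t*) *m phi X.
  have := @schwarz_multiplicative _ _ (phi \o trmx) (Y^T) hpsi.
  rewrite eT /= !trmxK gr -nrm => h.
  have := fixg _ hYs; rewrite trmxCK => /h/(_ X^T).
  rewrite trmxK trmx_mul trmxK /phi iter_dag => <-; congr (phi (_ *m _)).
  by apply/matrixP => i j; rewrite !mxE.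
have ePs : phi (Y ^t*) = (l ^+ n)^* *: Y ^t* by rewrite /phi iter_dag -/phi ePhi dagZ.
move: anti; rewrite /phi iter_peripheral_mulr // -/phi ePs -scalemxAl -scalemxAr.
by apply: scalerI; rewrite conjC_eq0.
Qed.

End Peripheral.

(** * Decay of iterates *)

Section FactorChain.
Local Open Scope sesquilinear_scope.
Variables (K : fieldType) (V : lmodType K) (f : {linear V -> V}).

(** The product of the commuting operators f - r, for r in rs, applied to x. A list of roots
    annihilating x plays the role of a factored polynomial and replaces a spectral decomposition. *)
Definition factor_chain (rs : seq K) (x : V) : V :=
  foldl (fun y r => f y - r *: y) x rs.

Lemma factor_chainB rs (a : K) x :
  factor_chain rs (f x - a *: x) = f (factor_chain rs x) - a *: factor_chain rs x.
Proof.
elim: rs x => //= r rs IH x; rewrite -IH; congr factor_chain.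
rewrite !(linearB f) !(linearZ_LR f) /= !scalerBr !scalerA [a * r]mulrC.
by rewrite !opprB !addrA [LHS](ACl (1*4*3*2)%AC).
Qed.

(** S is stable under every f - r, and f - r has no nonzero kernel vector in S when r fails P. Since
    the factors commute, such an r can be moved outermost and cancelled. *)
Lemma factor_chain_filter (S : V -> Prop) (P : pred K) rs x :
  (forall r x, S x -> S (f x - r *: x)) ->
  (forall r x, ~~ P r -> S x -> f x - r *: x = 0 -> x = 0) ->
  S x -> factor_chain rs x = 0 -> factor_chain (filter P rs) x = 0.
Proof.
move=> hS hP; have hc rs' y : S y -> S (factor_chain rs' y).
  by elim: rs' y => //= r rs' IH y hy; apply/IH/hS.
elim: rs x => //= r rs IH x hx h0.
have h1 := IH _ (hS r x hx) h0.
case: ifPn => // hr; move: h1; rewrite factor_chainB; apply: hP => //.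
exact: hc.
Qed.

Lemma factor_chain_nilpotent rs x m : all (pred1 0) rs -> (size rs <= m)%N ->
  factor_chain rs x = 0 -> iter m f x = 0.
Proof.
elim: rs x m => [|r rs IH] x m /=; first by move=> _ _ ->; exact: linear0.
case: m => // m /andP[/eqP -> h] hm; rewrite scale0r subr0 iterSr.
exact: IH.
Qed.

End FactorChain.

(** Cayley-Hamilton, with rs the roots of the characteristic polynomial. In size 0 the empty list
    will do, as every vector is zero. *)
Lemma factor_chain_mx (C : closedFieldType) n (A : 'M[C]_n) :
  exists rs : seq C, forall v : 'rV[C]_n, factor_chain (mulmxr A) rs v = 0.
Proof.
case: n A => [|n] A; first by exists [::] => v; apply/rowP => -[].
have [rs e] := closed_field_poly_normal (char_poly A).
exists rs => v; have := Cayley_Hamilton A.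
rewrite e (monicP (char_poly_monic A)) scale1r rmorph_prod /=.
move=> /(congr1 (mulmx v)); rewrite mulmx0 => <-.
elim: rs v {e} => [|r rs IH] v; first by rewrite big_nil mulmx1.
rewrite big_cons /= IH mulmxA; congr (_ *m _).
by rewrite rmorphB /= horner_mx_X horner_mx_C mulmxBr mul_mx_scalar.
Qed.

Lemma factor_chain_annihilator (C : closedFieldType) m n
    (f : {linear 'M[C]_(m, n) -> 'M[C]_(m, n)}) :
  exists rs : seq C, forall X, factor_chain f rs X = 0.
Proof.
have [rs hrs] := factor_chain_mx (lin_mx f).
exists rs => X; apply: (can_inj mxvecK); rewrite linear0 -[RHS](hrs (mxvec X)).
elim: rs X {hrs} => //= r rs IH X; rewrite IH; congr factor_chain.
by rewrite mul_vec_lin linearB linearZ.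
Qed.

(** * Matrix sequences tending to zero *)

Section Vanish.
Local Open Scope sesquilinear_scope.
Variable C : numClosedFieldType.

Definition vanishes m n (u : nat -> 'M[C]_(m, n)) :=
  forall e, 0 < e -> exists N, forall k, (N <= k)%N -> forall i j, `|u k i j| < e.

(** A [numClosedFieldType] may be non-Archimedean, so the decay of geometric sequences is a
    hypothesis until C is specialized to [R[i]]. *)
Definition archi_powers := forall r e : C, 0 <= r -> r < 1 -> 0 < e ->
  exists k, r ^+ k < e.

(** Past the index N, the inhomogeneous term is below (e / 2) (1 - |r|). The map x |-> |r| x + (e /
    2) (1 - |r|) has the fixed point e / 2, so only the geometric term |r|^k |u N| remains to be
    made small. *)
Lemma vanishes_recurrence (u v : nat -> C) (r : C) : archi_powers ->
  `|r| < 1 -> (forall k, u k.+1 = r * u k + v k) ->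
  (forall e, 0 < e -> exists N, forall k, (N <= k)%N -> `|v k| < e) ->
  forall e, 0 < e -> exists N, forall k, (N <= k)%N -> `|u k| < e.
Proof.
move=> ha hr hu hv e e0.
have s0 : 0 < 1 - `|r| by rewrite subr_gt0.
have [N hN] := hv (e / 2 * (1 - `|r|)) ltac:(by rewrite mulr_gt0 ?divr_gt0).
have bnd k : `|u (k + N)%N| <= `|r| ^+ k * `|u N| + e / 2.
  elim: k => [|k IH].
    by rewrite add0n expr0 mul1r lerDl divr_ge0 // ltW.
  rewrite addSn hu (le_trans (ler_normD _ _)) // normrM exprS -mulrA.
  have h1 := hN (k + N)%N (leq_addl _ _).
  have h2 : `|r| * `|u (k + N)%N| <= `|r| * (`|r| ^+ k * `|u N| + e / 2).
    by rewrite ler_wpM2l.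
  apply: le_trans (lerD h2 (ltW h1)) _.
  have -> : `|r| * (`|r| ^+ k * `|u N| + e / 2) + e / 2 * (1 - `|r|) =
    `|r| * (`|r| ^+ k * `|u N|) + e / 2 by ring.
  exact: lexx.
(* Adding 1 keeps the denominator positive when u N = 0. *)
have c0 : 0 < e / 2 / (`|u N| + 1).
  by rewrite !divr_gt0 // ltr_wpDl.
have [k0 hk0] := ha _ _ (normr_ge0 r) hr c0.
exists (k0 + N)%N => k hk; have hkN : (N <= k)%N := leq_trans (leq_addl _ _) hk.
rewrite -(subnK hkN); apply: le_lt_trans (bnd _) _.
rewrite [ltRHS](splitr e) ltrD2r.
have h1 : `|r| ^+ (k - N) <= `|r| ^+ k0.
  apply: ler_wiXn2l => //; first exact: ltW.
  by rewrite -(leq_add2r N) subnK.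
apply: le_lt_trans (ler_wpM2r (normr_ge0 _) h1) _.
apply: le_lt_trans (_ : `|r| ^+ k0 * (`|u N| + 1) < _).
  by rewrite ler_wpM2l ?exprn_ge0 // lerDl.
by rewrite -ltr_pdivlMr // ltr_wpDl.
Qed.

(** Induction on rs: if the iterates of f X - r X vanish in the limit, the entries of those of X
    satisfy u_(k+1) = r u_k + v_k with v tending to zero. *)
Lemma factor_chain_vanishes m n (f : {linear 'M[C]_(m, n) -> 'M[C]_(m, n)})
    (rs : seq C) X :
  archi_powers -> all (fun r => `|r| < 1) rs -> factor_chain f rs X = 0 ->
  vanishes (fun k => iter k f X).
Proof.
move=> ha; elim: rs X => [|r rs IH] X /=.
  move=> _ -> e e0; exists 0%N => k _ i j.
  by rewrite (linear0 (iter k f)) mxE normr0.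
move=> /andP[hr hrs] h0; have hY := IH _ hrs h0.
have hent i j : forall e, 0 < e ->
    exists N, forall k, (N <= k)%N -> `|iter k f X i j| < e.
  apply: (@vanishes_recurrence _ (fun k => iter k f (f X - r *: X) i j) r)
    => // [k|e /hY[N hN]]; last by exists N => k /hN; exact.
  rewrite (linearB (iter k f)) (linearZ_LR (iter k f)) /= -iterSr.
  by rewrite !mxE [RHS]addrC subrK.
move=> e e0.
have /choice[N hN] : forall ij : 'I_m * 'I_n, exists N, forall k, (N <= k)%N ->
    `|iter k f X ij.1 ij.2| < e by move=> ij; exact: hent.
exists (\max_ij N ij) => k hk i j.
by apply: (hN (i, j)); apply: leq_trans hk; exact: (leq_bigmax (i, j)).
Qed.

Lemma vanishes_sum_norm m n (u : nat -> 'M[C]_(m, n)) : vanishes u ->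
  forall e, 0 < e -> exists N, forall k, (N <= k)%N ->
  \sum_i \sum_j `|u k i j| <= e.
Proof.
(* The successor keeps the denominator nonzero for empty matrices. *)
move=> hu e e0; have e' : 0 < e / (m * n).+1%:R by rewrite divr_gt0 ?ltr0n.
have [N hN] := hu _ e'; exists N => k /hN h.
apply: le_trans (_ : \sum_(i < m) \sum_(j < n) (e / (m * n).+1%:R) <= _).
  by do 2!apply: ler_sum => ? _; exact: ltW.
rewrite !sumr_const !card_ord -mulrnA -[leLHS]mulr_natr -mulrA ger_pMr //.
by rewrite mulrC ler_pdivrMr ?ltr0n // mul1r ler_nat mulnC leqnSn.
Qed.

End Vanish.

(** * Spectral radius and decay off the peripheral space *)

Section Asymptotics.
Local Open Scope sesquilinear_scope.
Variables (C : numClosedFieldType) (d : nat) (tau : {linear 'M[C]_d -> 'M[C]_d}).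
Hypotheses (hS : schwarz_map tau) (hT : trace_preserving tau).
Implicit Types X Y : 'M[C]_d.

(** The trace of the Schwarz inequality at X reads (1 - |r|^2) tr (X^* X) >= 0. *)
Lemma eigenvalue_norm_le1 r X : tau X = r *: X -> X != 0 -> `|r| <= 1.
Proof.
move=> e X0; have := proj2 (hS X).
move=> /psdmx_gramP[B /(congr1 mxtrace)].
rewrite linearB /= hT e dagZ -scalemxAl -scalemxAr scalerA mulrC -normCK linearZ /=.
move=> eB; have := mxtrace_gram_ge0 B; rewrite -eB -{1}[\tr _]mul1r -mulrBl.
have t0 : 0 < \tr (X ^t* *m X).
  rewrite lt_def mxtrace_gram_ge0 andbT; apply: contra X0 => /eqP h.
  by rewrite (mxtrace_gram_eq0 h).
by rewrite pmulr_lge0 // subr_ge0 expr_le1.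
Qed.

(** The orthogonality condition is stable under tau, because l tr (Y tau Z) = tr (tau (Y Z)) = tr (Y
    Z). It admits no nonzero eigenvector Z of modulus 1, since Z^* would be peripheral and give tr
    (Z^* Z) = 0. Only roots of modulus less than 1 survive in the annihilating product. *)
Lemma peripheral_orthogonal_vanishes X : archi_powers C ->
  (forall Y, peripheral tau Y -> \tr (Y *m X) = 0) ->
  vanishes (fun k => iter k tau X).
Proof.
move=> ha hX; have [rs hrs] := factor_chain_annihilator tau.
apply: (@factor_chain_vanishes _ _ _ tau [seq r <- rs | `|r| < 1]) => //.
  exact: filter_all.
apply: (factor_chain_filter (S := fun Z =>
  forall Y, peripheral tau Y -> \tr (Y *m Z) = 0)) => //.
  move=> r Z hZ Y hY; have [l [hl e]] := hY.
  have l0 : l != 0 by rewrite -normr_eq0 hl oner_neq0.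
  rewrite mulmxBr linearB /= -scalemxAr linearZ /= hZ // mulr0 subr0.
  have : \tr (tau (Y *m Z)) = 0 by rewrite hT hZ.
  rewrite (peripheral_mull hS) // e -scalemxAl linearZ /= => /eqP.
  by rewrite mulf_eq0 (negPf l0) => /eqP.
move=> r Z hr hZ /eqP; rewrite subr_eq0 => /eqP e.
apply/eqP; apply: contraNT hr => Z0.
have := eigenvalue_norm_le1 e Z0; rewrite le_eqVlt => /orP[/eqP h|//].
have hp : peripheral tau Z by exists r.
have := hZ _ (peripheral_dag hS hp) => /mxtrace_gram_eq0 z0.
by rewrite z0 eqxx in Z0.
Qed.

Hypothesis hcomm : forall (r : C) X Y, r != 0 -> tau X = r *: X ->
  peripheral tau Y -> X *m Y = Y *m X.

Lemma iter_commute_peripheral : exists M, forall m, (M <= m)%N ->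
  forall X Y, peripheral tau Y -> iter m tau X *m Y = Y *m iter m tau X.
Proof.
have [rs hrs] := factor_chain_annihilator tau.
exists (size rs) => m hm X Y hY.
have [l [hl e]] := hY.
have l0 : l ^+ m != 0 by rewrite expf_neq0 // -normr_eq0 hl oner_neq0.
(* Multiplicativity at Y gives tau^m [X, Y] = l^m [tau^m X, Y]. The bound [size rs] is thus uniform
   in X and Y. *)
suff h : iter m tau (X *m Y - Y *m X) = 0.
  move: h; rewrite linearB /= (iter_peripheral_mulr hS hT m X hY).
  rewrite (iter_peripheral_mull hS hT m X hY) (iter_eigen m e).
  rewrite -scalemxAl -scalemxAr -scalerBr => /eqP.
  by rewrite scaler_eq0 (negPf l0) subr_eq0 => /eqP.
apply: (@factor_chain_nilpotent _ _ tau (filter (pred1 0) rs)).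
- exact: filter_all.
- by apply: leq_trans hm; rewrite size_filter count_size.
apply: (factor_chain_filter (S := fun Z => exists X, Z = X *m Y - Y *m X)) => //.
- move=> r _ [Z ->]; exists (l *: tau Z - r *: Z).
  rewrite linearB /= (peripheral_mull hS hT Z hY) (peripheral_mulr hS hT Z hY) e.
  rewrite mulmxBl mulmxBr -!scalemxAl -!scalemxAr scalerBr.
  by rewrite !opprB !addrA [LHS](ACl (1*4*3*2)%AC).
(* For Z = [W, Y], commuting with Y^* means that Z^* commutes with Y, so tr (Z^* [W, Y]) = 0 by
   cyclicity. *)
- move=> r Z r0 [W eW] /eqP; rewrite subr_eq0 => /eqP eZ.
  have hz := hcomm r0 eZ (peripheral_dag hS hY).
  have hz' : Y *m Z ^t* = Z ^t* *m Y.
    by have := congr1 (fun A => A ^t*) hz; rewrite !dagM trmxCK.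
  apply: mxtrace_gram_eq0; rewrite {2}eW mulmxBr linearB /= mulmxA mxtrace_mulC.
  by rewrite !mulmxA hz' subrr.
- by exists X.
Qed.

End Asymptotics.

(** Among the finite families in S, take one whose span has maximal dimension; adjoining an element
    of S cannot enlarge that span. *)
Lemma finite_generating_seq (K : fieldType) (V : vectType K) (S : V -> Prop) :
  exists s : seq V, (forall x, x \in s -> S x) /\ forall x, S x -> x \in <<s>>%VS.
Proof.
pose P n := `[< exists2 s : seq V, (forall x, x \in s -> S x) & \dim <<s>> = n >].
have [n /asboolP[s hs dn] nmax] : {n | P n & forall m, P m -> (m <= n)%N}.
  have ex : exists n, P n.
    by exists 0%N; apply/asboolP; exists [::] => //; rewrite span_nil dimv0.
  have ub m : P m -> (m <= \dim {:V})%N.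
    by move=> /asboolP[s _ <-]; apply/dimvS/subvf.
  by case: (ex_maxnP ex ub) => n; exists n.
exists s; split=> // x hx.
have h : P (\dim <<x :: s>>).
  by apply/asboolP; exists (x :: s) => // y; rewrite inE => /predU1P[->|/hs].
have := nmax _ h; rewrite -dn => le.
have sub : (<<s>> <= <<x :: s>>)%VS by rewrite span_cons addvSr.
have /eqP -> : <<s>>%VS == <<x :: s>>%VS by rewrite eqEdim sub.
by rewrite memv_span // mem_head.
Qed.

(** * Simultaneous unitary diagonalization *)

Section Codiagonal.
Local Open Scope sesquilinear_scope.
Variables (C : numClosedFieldType) (d : nat).

(** Triangularize a finite generating family together with its adjoints: a matrix that is triangular
    along with its adjoint is diagonal, and linearity covers the rest of S. *)
Lemma codiagonalization (S : 'M[C]_d -> Prop) :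
  (forall A, S A -> S (A ^t*)) ->
  (forall A B, S A -> S B -> A *m B = B *m A) ->
  exists2 Q : 'M[C]_d, Q \is unitarymx &
    forall A, S A -> is_diag_mx (Q *m A *m Q ^t*).
Proof.
move=> hdag hcomm; have [s [hs gen]] := finite_generating_seq S.
have [|Q hQ /allP h] := @cotrigonalization C d (s ++ map (fun A => A ^t*) s).
  have aux A : A \in s ++ map (fun A => A ^t*) s -> S A.
    by rewrite mem_cat => /orP[/hs//|/mapP[B /hs/hdag hB ->]].
  by move=> A B /aux hA /aux hB; exact: hcomm.
exists Q => // A /gen; pose D B := is_diag_mx (Q *m B *m Q ^t*).
have hD B : B \in s -> D B.
  move=> hB; have trig X : X \in s ++ map (fun A => A ^t*) s ->
      is_trig_mx (Q *m X *m Q ^t*).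
    by move=> /h; rewrite /= /similar_to conjymx.
  have t1 := trig B ltac:(by rewrite mem_cat hB).
  have t2 : is_trig_mx (Q *m B ^t* *m Q ^t*).
    by apply: trig; rewrite mem_cat (map_f (fun A : 'M[C]_d => A ^t*) hB) orbT.
  apply/is_diag_mxP => i j; rewrite neq_ltn => /orP[ij|ji].
    by move/is_trig_mxP: t1; exact.
  have e : Q *m B *m Q ^t* = (Q *m B ^t* *m Q ^t*) ^t*.
    by rewrite !dagM !trmxCK mulmxA.
  by rewrite e dagE; move/is_trig_mxP: t2 => -> //; rewrite conjC0.
move=> /(@coord_span _ _ _ (in_tuple s)) ->; rewrite -/(D _) /D.
rewrite mulmx_sumr mulmx_suml; apply/is_diag_mxP => i j ij.
rewrite summxE big1 // => k _; rewrite -scalemxAr -scalemxAl mxE.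
by move/is_diag_mxP: (hD _ (mem_nth 0 (ltn_ord k))) => ->; rewrite ?mulr0.
Qed.

End Codiagonal.

(** * The dephasing cone *)

Section DephasingCone.
Local Open Scope sesquilinear_scope.
Variables (C : numClosedFieldType) (d : nat).
Implicit Types (U V X : 'M[C]_d) (Phi : 'M[C]_d -> 'M[C]_d) (s : 'S_d).

(** The weights are not normalized, so that sums and scalings stay inside; [dephasing_cone_MTD]
    recovers the normalization from a trace. *)
Definition dephasing_cone Phi := exists ts : seq (C * ('M[C]_d * 'M[C]_d)),
  (forall t, t \in ts ->
    [/\ 0 <= t.1, t.2.1 \is unitarymx & t.2.2 \is unitarymx]) /\
  forall X, Phi X = \sum_(t <- ts) t.1 *: twisted_dephasing t.2.1 t.2.2 X.

Lemma dephasing_cone_ext Phi Psi : (forall X, Phi X = Psi X) ->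
  dephasing_cone Psi -> dephasing_cone Phi.
Proof. by move=> e [ts [h1 h2]]; exists ts; split=> // X; rewrite e. Qed.

Lemma dephasing_cone0 : dephasing_cone (fun=> 0).
Proof. by exists [::]; split=> // X; rewrite big_nil. Qed.

Lemma dephasing_coneD Phi Psi : dephasing_cone Phi -> dephasing_cone Psi ->
  dephasing_cone (fun X => Phi X + Psi X).
Proof.
move=> [ts [h1 h2]] [ts' [h1' h2']]; exists (ts ++ ts'); split=> [t|X].
  by rewrite mem_cat => /orP[/h1|/h1'].
by rewrite big_cat /= h2 h2'.
Qed.

Lemma dephasing_coneZ c Phi : 0 <= c -> dephasing_cone Phi ->
  dephasing_cone (fun X => c *: Phi X).
Proof.
move=> c0 [ts [h1 h2]]; exists [seq (c * t.1, t.2) | t <- ts].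
split=> [_ /mapP[t /h1[? ? ?] ->]|X].
  by split=> //=; rewrite mulr_ge0.
by rewrite h2 scaler_sumr big_map; apply: eq_bigr => t _; rewrite scalerA.
Qed.

Lemma dephasing_cone_sum (I : Type) (r : seq I) (P : pred I)
    (Phi : I -> 'M[C]_d -> 'M[C]_d) :
  (forall i, P i -> dephasing_cone (Phi i)) ->
  dephasing_cone (fun X => \sum_(i <- r | P i) Phi i X).
Proof.
move=> h; elim: r => [|i r IH].
  by apply: dephasing_cone_ext dephasing_cone0 => X; rewrite big_nil.
apply: (dephasing_cone_ext (Psi := fun X => (if P i then Phi i X else 0) +
    \sum_(j <- r | P j) Phi j X)).
  by move=> X; rewrite big_cons; case: ifP; rewrite ?add0r.
apply: dephasing_coneD => //.
by case hP: (P i); [exact: h|exact: dephasing_cone0].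
Qed.

(** This is the twisted dephasing channel of U P_s^* and V: the outcome l of the measurement along V
    prepares column s l of U. *)
Definition perm_dephasing U V s X :=
  \sum_l (V ^t* *m X *m V) l l *: (U *m delta_mx (s l) (s l) *m U ^t*).

Lemma perm_mx_unitary s : (perm_mx s : 'M[C]_d) \is unitarymx.
Proof.
apply/unitarymxP; rewrite tr_perm_mx map_perm_mx -perm_mxM mulgV.
exact: perm_mx1.
Qed.

Lemma perm_mx_dag s : (perm_mx s : 'M[C]_d) ^t* = perm_mx s^-1%g.
Proof. by rewrite tr_perm_mx map_perm_mx. Qed.

Lemma perm_conj s X i j : (perm_mx s *m X *m (perm_mx s) ^t*) i j = X (s i) (s j).
Proof. by rewrite perm_mx_dag -col_permE -row_permE !mxE. Qed.

Lemma perm_dephasing_cone U V s : U \is unitarymx -> V \is unitarymx ->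
  dephasing_cone (perm_dephasing U V s).
Proof.
move=> hU hV; exists [:: (1, (U *m (perm_mx s) ^t*, V))]; split=> [t|X].
  rewrite inE => /eqP -> /=; split=> //; rewrite ?ler01 //.
  by rewrite mul_unitarymx // trmxC_unitary perm_mx_unitary.
rewrite big_seq1 scale1r twisted_dephasingE; apply: eq_bigr => l _.
congr (_ *: _).
  by rewrite -AdE /Ad trmxCK.
rewrite dagM trmxCK !mulmxA; congr (_ *m _); rewrite -!mulmxA; congr (_ *m _).
apply/matrixP => i j; rewrite mulmxA -{2}[perm_mx s]trmxCK perm_mx_dag perm_conj !mxE.
by rewrite !(can2_eq (permKV s) (permK s)).
Qed.

End DephasingCone.

(** * Blocks of basis indices, their projections and block-diagonal matrices *)

Section Blocks.
Local Open Scope sesquilinear_scope.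
Variables (C : numClosedFieldType) (d : nat) (b : 'I_d -> 'I_d).
Implicit Types (U V X A B : 'M[C]_d) (s : 'S_d).

(** The blocks are the fibres of b; a label outside the image of b gives the zero projection. *)
Definition block_proj c : 'M[C]_d := diag_mx (\row_k (b k == c)%:R).

Definition block_size k : C := #|[pred l | b l == b k]|%:R.

(** This is Omega, the trace-preserving conditional expectation onto the span of the block
    projections. *)
Definition block_depolarizing X : 'M[C]_d :=
  diag_mx (\row_k ((\sum_(l | b l == b k) X l l) / block_size k)).

Definition block_diagonal A := forall i j, b i != b j -> A i j = 0.

Definition block_perms := [set s : 'S_d | [forall k, b (s k) == b k]]%SET.

Lemma block_projE c i j : block_proj c i j = ((i == j) && (b i == c))%:R.
Proof. by rewrite !mxE; have [->|] := eqVneq i j; rewrite ?mulr1n. Qed.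

Lemma block_size_gt0 k : 0 < block_size k.
Proof. by rewrite ltr0n; apply/card_gt0P; exists k; rewrite inE. Qed.

Lemma block_size_eq k l : b k = b l -> block_size k = block_size l.
Proof. by rewrite /block_size => ->. Qed.

Lemma mul_block_proj c A i j : (block_proj c *m A) i j = (b i == c)%:R * A i j.
Proof. by rewrite mul_diag_mx !mxE. Qed.

Lemma mul_proj_block c A i j : (A *m block_proj c) i j = (b j == c)%:R * A i j.
Proof. by rewrite mul_mx_diag !mxE mulrC. Qed.

Lemma block_diagonalP A :
  (forall c, block_proj c *m A = A *m block_proj c) <-> block_diagonal A.
Proof.
split=> [h i j ij|h c].
  have := congr1 (fun M : 'M_d => M i j) (h (b i)).
  rewrite mul_block_proj mul_proj_block eqxx eq_sym (negPf ij).
  by rewrite mul0r mul1r.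
apply/matrixP => i j; rewrite mul_block_proj mul_proj_block.
by have [->//|/h ->] := eqVneq (b i) (b j); rewrite !mulr0.
Qed.

Lemma block_proj_sum : \sum_c block_proj c = 1%:M.
Proof.
apply/matrixP => i j; rewrite summxE mxE (bigD1 (b i)) //= big1 ?addr0.
  by rewrite block_projE eqxx andbT.
by move=> c hc; rewrite block_projE [b i == c]eq_sym (negPf hc) andbF.
Qed.

Lemma block_proj_mul c c' : block_proj c *m block_proj c' =
  (c == c')%:R *: block_proj c.
Proof.
apply/matrixP => i j; rewrite mul_block_proj [RHS]mxE !block_projE.
by case: (i =P j) => [_|]; rewrite ?mulr0 //=; case: (b i =P c) => [->|_];
   rewrite ?mul0r ?mulr0 // mul1r mulr1.
Qed.

Lemma block_proj_dag c : (block_proj c) ^t* = block_proj c.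
Proof.
apply/matrixP => i j; rewrite dagE !block_projE conjC_nat eq_sym.
by case: eqP => [->|].
Qed.

Lemma block_proj_trace c : \tr (block_proj c) = \sum_k (b k == c)%:R.
Proof. by apply: eq_bigr => k _; rewrite block_projE eqxx. Qed.

(** The diagonals have entries 0 or 1, and each index carries a 1 in exactly one D c, which defines
    a second labelling b'. Equal traces mean that each label occurs equally often in b and b', so a
    permutation matches them. *)
Lemma block_proj_relabel (D : 'I_d -> 'M[C]_d) :
  (forall c, is_diag_mx (D c)) -> (forall c, D c *m D c = D c) ->
  \sum_c D c = 1%:M -> (forall c, \tr (D c) = \tr (block_proj c)) ->
  exists w : 'S_d, forall c, perm_mx w *m D c *m (perm_mx w) ^t* = block_proj c.
Proof.
move=> hdiag hidem hsum htr.
have h01 c k : D c k k = 0 \/ D c k k = 1.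
  have := congr1 (fun M : 'M_d => M k k) (hidem c).
  rewrite /= mxE (bigD1 k) //= big1 ?addr0 => [/eqP|j jk].
    rewrite -subr_eq0 -{3}[D c k k]mulr1 -mulrBr mulf_eq0 subr_eq0.
    by case/orP=> /eqP; [left|right].
  by move/is_diag_mxP: (hdiag c) => ->; rewrite ?mul0r // eq_sym.
have hs k : \sum_c D c k k = 1.
  by have := congr1 (fun M : 'M_d => M k k) hsum; rewrite summxE mxE eqxx.
have hex k : exists c, forall c', D c' k k = (c' == c)%:R.
  have [c hc] : exists c, D c k k = 1.
    apply: contrapT => hn; have := hs k; rewrite big1 => [/eqP|c _].
      by rewrite eq_sym oner_eq0.
    by case: (h01 c k) => // h; case: hn; exists c.
  exists c => c'; have [->//|cc] := eqVneq c' c.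
  have := hs k; rewrite (bigD1 c) //= hc => /eqP.
  rewrite -[eqbRHS]addr0 (inj_eq (addrI 1)) psumr_eq0 => [/allP/(_ c')|i _].
    by rewrite mem_index_enum cc => /(_ isT)/eqP.
  by case: (h01 i k) => ->.
have [b' hb'] := choice hex.
pose tup (g : 'I_d -> 'I_d) := [tuple g k | k < d].
have cE (g : 'I_d -> 'I_d) c :
    (count_mem c (tup g))%:R = \sum_k (g k == c)%:R :> C.
  rewrite count_map -sum1_count natr_sum big_mkcond big_enum /=.
  by apply: eq_bigr => k _; case: eqP.
have cnt c : count_mem c (tup b) = count_mem c (tup b').
  apply/eqP; rewrite -(eqr_nat C) !cE -block_proj_trace -htr; apply/eqP.
  by apply: eq_bigr => k _; rewrite hb' eq_sym.
have /tuple_permP[w hw] : perm_eq (tup b) (tup b').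
  by apply/allP => c _ /=; rewrite cnt.
have bw k : b k = b' (w k).
  have /val_inj/(congr1 (fun t => tnth t k)) := hw.
  by rewrite !tnth_mktuple.
exists w => c; apply/matrixP => i j; rewrite perm_conj block_projE.
have [->|ij] := eqVneq i j; first by rewrite hb' -bw eq_sym.
by move/is_diag_mxP: (hdiag c) => ->; rewrite // (inj_eq val_inj) (inj_eq perm_inj).
Qed.

(** Diagonalizing A jointly with the block projections may move the latter to other diagonal
    projections of equal trace. A permutation brings them back, and the resulting unitary commutes
    with all of them. *)
Lemma hermitian_block_diag A : A ^t* = A -> block_diagonal A ->
  exists2 U, U \is unitarymx /\ block_diagonal U &
  exists2 a : 'I_d -> C, (forall k, a k \is Num.real) &
    A = U *m diag_mx (\row_k a k) *m U ^t*.
Proof.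
move=> hA /block_diagonalP bA.
pose S X := X = A \/ exists c, X = block_proj c.
have [X [->|[c ->]]|X Y|Q hQ hD] := @codiagonalization C d S.
- by left; rewrite hA.
- by right; exists c; rewrite block_proj_dag.
- move=> [->|[c ->]] [->|[c' ->]] //; rewrite ?bA // !block_proj_mul.
  by rewrite eq_sym; case: eqP => [->|]; rewrite ?scale0r.
have Qs := unitarymx_dagl hQ; have Qs' := unitarymxP hQ.
have [] := @block_proj_relabel (fun c => Q *m block_proj c *m Q ^t*).
- by move=> c; apply: hD; right; exists c.
- move=> c; rewrite !mulmxA -[_ *m Q ^t* *m Q]mulmxA Qs mulmx1.
  by rewrite -[Q *m _ *m _]mulmxA block_proj_mul eqxx scale1r.
- by rewrite -mulmx_suml -mulmx_sumr block_proj_sum mulmx1 Qs'.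
- by move=> c; rewrite mxtrace_mulC mulmxA Qs mul1mx.
move=> w hw.
have DA : is_diag_mx (Q *m A *m Q ^t*) by apply: hD; left.
have [M [hM hMc hMA]] : exists M : 'M[C]_d, [/\ M \is unitarymx,
    forall c, M *m block_proj c *m M ^t* = block_proj c &
    is_diag_mx (M *m A *m M ^t*)].
  exists (perm_mx w *m Q); split.
  - by rewrite mul_unitarymx // perm_mx_unitary.
  - by move=> c; rewrite dagM -[RHS]hw !mulmxA.
  - have -> : perm_mx w *m Q *m A *m (perm_mx w *m Q) ^t* =
        perm_mx w *m (Q *m A *m Q ^t*) *m (perm_mx w) ^t*.
      by rewrite dagM !mulmxA.
    apply/is_diag_mxP => i j ij; rewrite perm_conj.
    move/is_diag_mxP: DA => -> //.
    by rewrite (inj_eq val_inj) (inj_eq perm_inj).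
have Ms := unitarymx_dagl hM.
exists (M ^t*); first split; first by rewrite trmxC_unitary.
  apply/block_diagonalP => c.
  by rewrite -[in RHS]hMc !mulmxA Ms mul1mx.
exists (fun k => (M *m A *m M ^t*) k k) => [k|].
  by apply/CrealP; rewrite -dagE !dagM !trmxCK hA !mulmxA.
have -> : diag_mx (\row_k (M *m A *m M ^t*) k k) = M *m A *m M ^t*.
  apply/matrixP => i j; rewrite mxE [X in X *+ _]mxE.
  have [<-|ij] := eqVneq i j; first by rewrite mulr1n.
  by rewrite mulr0n; move/is_diag_mxP: hMA => ->.
by rewrite trmxCK !mulmxA Ms mul1mx -mulmxA Ms mulmx1.
Qed.

End Blocks.

(** * Perturbations of the block-depolarizing map inside the cone *)

Section NearDepolarizing.
Local Open Scope sesquilinear_scope.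
Variables (C : numClosedFieldType) (d : nat) (b : 'I_d -> 'I_d).
Implicit Types (U V X A B : 'M[C]_d) (s : 'S_d).
Local Notation p := (block_proj C b).
Local Notation G := (block_perms b).
Local Notation F U k := (U *m delta_mx k k *m U ^t*).

Lemma block_permsP s : reflect (forall k, b (s k) = b k) (s \in G).
Proof. by rewrite inE; apply: (iffP forallP) => h k; apply/eqP. Qed.

Lemma block_perms_gt0 : 0 < #|G|%:R :> C.
Proof.
rewrite ltr0n; apply/card_gt0P; exists 1%g.
by apply/block_permsP => k; rewrite perm1.
Qed.

Lemma tperm_block k l : b k = b l -> forall m, b (tperm k l m) = b m.
Proof. by move=> e m; case: tpermP => [->|->|]. Qed.

Lemma block_proj_conj U c : U \is unitarymx -> block_diagonal b U ->
  U *m p c *m U ^t* = p c.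
Proof.
move=> /unitarymxP hU /block_diagonalP <-.
by rewrite -mulmxA hU mulmx1.
Qed.

Lemma block_proj_delta c : p c = \sum_(k | b k == c) delta_mx k k.
Proof.
apply/matrixP => i j; rewrite block_projE summxE.
have [<-|ij] /= := eqVneq i j; last first.
  rewrite big1 // => k _; rewrite mxE; case: eqP => //= e; case: eqP => //= e'.
  by rewrite e e' eqxx in ij.
case: (boolP (b i == c)) => bi; last first.
  rewrite big1 // => k bk; rewrite mxE; case: eqP => //= e; move: bi.
  by rewrite e bk.
rewrite (bigD1 i) //= mxE !eqxx big1 ?addr0 // => k /andP[_ ki].
by rewrite mxE eq_sym (negPf ki).
Qed.

(** Translating the group by a transposition shows that the sum depends only on the block of l.
    Summed over that block, each s contributes the whole projection. *)
Lemma block_perms_sum U l : U \is unitarymx -> block_diagonal b U ->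
  \sum_(s in G) F U (s l) = (#|G|%:R / block_size C b l) *: p (b l).
Proof.
move=> hU bU; pose S k := \sum_(s in G) F U (s k).
have SE k : b k = b l -> S k = S l.
  move=> kl; rewrite /S (reindex_inj (mulgI (tperm k l))) /=.
  apply: eq_big => [s|s _]; last by rewrite permM tpermL.
  apply/block_permsP/block_permsP => h m.
    by have := h (tperm k l m); rewrite permM tpermK tperm_block.
  by rewrite permM h tperm_block.
have e : \sum_(k | b k == b l) S k = #|G|%:R *: p (b l).
  rewrite /S exchange_big /=.
  rewrite (eq_bigr (fun=> p (b l))) => [|s /block_permsP hs].
    by rewrite sumr_const -scaler_nat.
  rewrite -[RHS](block_proj_conj (b l) hU bU) block_proj_delta mulmx_sumr mulmx_suml.
  rewrite [RHS](reindex_inj (@perm_inj _ s)) /=.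
  by apply: eq_bigl => k; rewrite hs.
rewrite (eq_bigr (fun=> S l)) in e; last by move=> k /eqP/SE.
rewrite sumr_const -scaler_nat in e.
rewrite -/(S l) mulrC -scalerA -e scalerA mulVf ?scale1r //.
exact: lt0r_neq0 (block_size_gt0 _ _ _).
Qed.

Lemma mxtrace_block_proj c A : \tr (p c *m A) = \sum_(l | b l == c) A l l.
Proof.
rewrite [RHS]big_mkcond; apply: eq_bigr => l _; rewrite mul_block_proj.
by case: eqP; rewrite ?mul1r ?mul0r.
Qed.

Lemma block_depolarizingE X i j : block_depolarizing b X i j =
  (\tr (p (b i) *m X) / block_size C b i) * (i == j)%:R.
Proof. by rewrite !mxE mxtrace_block_proj mulr_natr. Qed.

Lemma block_depolarizing_avg U V X : U \is unitarymx -> V \is unitarymx ->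
  block_diagonal b U -> block_diagonal b V ->
  \sum_(s in G) perm_dephasing U V s X = #|G|%:R *: block_depolarizing b X.
Proof.
move=> hU hV bU bV; rewrite /perm_dephasing exchange_big /=.
under eq_bigr do rewrite -scaler_sumr block_perms_sum //.
apply/matrixP => i j; rewrite summxE [RHS]mxE block_depolarizingE.
under eq_bigr do rewrite mxE [(_ *: p _) i j]mxE block_projE.
have [_|ij] /= := eqVneq i j; last first.
  by rewrite !mulr0 big1 // => k _; rewrite !mulr0.
have -> : \tr (p (b i) *m X) = \tr (p (b i) *m (V ^t* *m X *m V)).
  rewrite -{1}(block_proj_conj (b i) hV bV) -!mulmxA mxtrace_mulC.
  by rewrite !mulmxA.
rewrite mxtrace_block_proj mulr1 mulr_suml mulr_sumr [RHS]big_mkcond.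
apply: eq_bigr => l _; rewrite eq_sym; case: eqP => [e|_]; last by rewrite !mulr0.
by rewrite (block_size_eq _ e) mulr1 mulrCA.
Qed.

Lemma block_depolarizing_cone t : 0 <= t ->
  dephasing_cone (fun X => t *: block_depolarizing b X).
Proof.
move=> t0; have h1 : (1%:M : 'M[C]_d) \is unitarymx.
  by apply/unitarymxP; rewrite dag1 mulmx1.
have b1 : block_diagonal b (1%:M : 'M[C]_d).
  by apply/block_diagonalP => c; rewrite mul1mx mulmx1.
apply: (dephasing_cone_ext (Psi := fun X =>
    (t / #|G|%:R) *: \sum_(s in G) perm_dephasing 1%:M 1%:M s X)).
  move=> X; rewrite block_depolarizing_avg // scalerA mulfVK //.
  exact: lt0r_neq0 block_perms_gt0.
apply: dephasing_coneZ; first by rewrite divr_ge0 // ltW ?block_perms_gt0.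
by apply: dephasing_cone_sum => s _; apply: perm_dephasing_cone.
Qed.

(** In the uniform average giving t Omega, each permutation has weight t / #|G|, which is large
    enough to absorb c at s1 and - c at s2. *)
Lemma perm_dephasing_perturb U V s1 s2 c t :
  U \is unitarymx -> V \is unitarymx ->
  block_diagonal b U -> block_diagonal b V -> s1 \in G -> s2 \in G ->
  c \is Num.real -> `|c| * #|G|%:R <= t ->
  dephasing_cone (fun X => t *: block_depolarizing b X +
    c *: (perm_dephasing U V s1 X - perm_dephasing U V s2 X)).
Proof.
move=> hU hV bU bV hs1 hs2 cr ht.
have g0 := block_perms_gt0; have gn0 := lt0r_neq0 g0.
have ct : `|c| <= t / #|G|%:R by rewrite ler_pdivlMr.
pose w s := t / #|G|%:R + c * (s == s1)%:R - c * (s == s2)%:R.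
apply: (dephasing_cone_ext (Psi := fun X =>
    \sum_(s in G) w s *: perm_dephasing U V s X)).
  move=> X; rewrite /w; under eq_bigr do rewrite scalerBl scalerDl.
  rewrite big_split sumrN big_split /= -scaler_sumr block_depolarizing_avg //.
  rewrite scalerA mulfVK // -addrA; congr (_ + _); rewrite scalerBr.
  have pick s0 : s0 \in G ->
      \sum_(s in G) (c * (s == s0)%:R) *: perm_dephasing U V s X =
      c *: perm_dephasing U V s0 X.
    move=> hs0; rewrite (bigD1 s0) //= eqxx mulr1 big1 ?addr0 //.
    move=> s /andP[_ /negPf ->].
    by rewrite mulr0 scale0r.
  by rewrite !pick.
apply: dephasing_cone_sum => s _.
apply: dephasing_coneZ; last exact: perm_dephasing_cone.
have c1 : c <= t / #|G|%:R := le_trans (real_ler_norm cr) ct.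
have c2 : - c <= t / #|G|%:R.
  by apply: le_trans ct; rewrite -normrN real_ler_norm ?rpredN.
rewrite /w.
have t0 : 0 <= t / #|G|%:R by apply: le_trans ct.
case: (s == s1); case: (s == s2); rewrite ?mulr1 ?mulr0 ?subr0 ?addr0 ?addrK //.
  by rewrite -lerBlDr sub0r.
by rewrite subr_ge0.
Qed.

Definition entry_norm A : C := \sum_i \sum_j `|A i j|.

Lemma entry_norm_ge0 A : 0 <= entry_norm A.
Proof. by do 2!apply: sumr_ge0 => ? _. Qed.

Lemma unitarymx_entry_le1 U i j : U \is unitarymx -> `|U i j| <= 1.
Proof.
move=> /unitarymxP/(congr1 (fun M : 'M_d => M i i)).
rewrite mxE [RHS]mxE eqxx mulr1n (bigD1 j) //= dagE -normCK => h.
rewrite -(@expr_le1 _ 2) // -h lerDl; apply: sumr_ge0 => k _.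
by rewrite dagE -normCK exprn_ge0.
Qed.

Lemma conj_entry_le U A k : U \is unitarymx -> `|(U ^t* *m A *m U) k k| <= entry_norm A.
Proof.
move=> hU; rewrite mxE (le_trans (ler_norm_sum _ _ _)) //.
rewrite /entry_norm exchange_big; apply: ler_sum => j _.
rewrite mxE normrM -[leRHS]mulr1 ler_pM //; last exact: unitarymx_entry_le1.
rewrite (le_trans (ler_norm_sum _ _ _)) //; apply: ler_sum => i _.
rewrite normrM dagE norm_conjC -[leRHS]mul1r ler_wpM2r //.
exact: unitarymx_entry_le1.
Qed.

(** The block is named by one of its indices o, which later serves as the reference index of the
    swaps. *)
Definition block_supported o A := forall i j, b i != b o \/ b j != b o -> A i j = 0.

Lemma block_supported_diagonal o A : block_supported o A -> block_diagonal b A.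
Proof.
move=> h i j ij; apply: h; have [e|] := eqVneq (b i) (b o); last by left.
by right; rewrite -e eq_sym.
Qed.

Lemma hermitian_supported_diag o A : A ^t* = A -> block_supported o A ->
  \tr A = 0 ->
  exists U (a : 'I_d -> C), [/\ U \is unitarymx, block_diagonal b U,
    A = \sum_k a k *: F U k,
    [/\ forall k, a k \is Num.real, forall k, b k != b o -> a k = 0 & \sum_k a k = 0] &
    forall k, `|a k| <= entry_norm A].
Proof.
move=> hA sA trA.
have [U [hU bU] [a ar eA]] := hermitian_block_diag hA (block_supported_diagonal sA).
have aE k : a k = (U ^t* *m A *m U) k k.
  rewrite eA !mulmxA (unitarymx_dagl hU) mul1mx -mulmxA (unitarymx_dagl hU) mulmx1.
  by rewrite !mxE eqxx mulr1n.
exists U, a; split=> //; last by move=> k; rewrite aE; exact: conj_entry_le.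
- rewrite eA; have -> : diag_mx (\row_k a k) = \sum_k a k *: delta_mx k k.
    rewrite diag_mx_sum_delta; apply: eq_bigr => k _; by rewrite mxE.
  rewrite mulmx_sumr mulmx_suml; apply: eq_bigr => k _.
  by rewrite -scalemxAr -scalemxAl.
- split=> // [k ko|].
    rewrite aE mxE big1 // => j _; rewrite mxE big1 ?mul0r // => i _.
    have [e|ne] := eqVneq (b i) (b k).
      by rewrite (sA i j) ?mulr0 //; left; rewrite e.
    by rewrite dagE bU // conjC0 mul0r.
- rewrite -[RHS]trA eA mxtrace_mulC mulmxA (unitarymx_dagl hU) mul1mx.
  by rewrite mxtrace_diag; apply: eq_bigr => k _; rewrite mxE.
Qed.

Lemma delta_conj_trace V X l : \tr (F V l *m X) = (V ^t* *m X *m V) l l.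
Proof.
rewrite -!mulmxA mxtrace_mulC -!mulmxA; set M := V ^t* *m (X *m V).
rewrite -(mul_delta_mx (0 : 'I_1)) -mulmxA mxtrace_mulC -rowE -colE.
by rewrite /mxtrace big_ord1 !mxE.
Qed.

(* With x_l = (V^* X V)_ll, the difference (x_l - x_o)(F_k - F_o) is that of the
   permutation channels of two permutations, which differ by swapping the
   images of l and o. *)
Lemma dephasing_cone_swap U V o k l c t :
  U \is unitarymx -> V \is unitarymx ->
  block_diagonal b U -> block_diagonal b V -> b k = b o -> b l = b o ->
  c \is Num.real -> `|c| * #|G|%:R <= t ->
  dephasing_cone (fun X => t *: block_depolarizing b X +
    (c * ((V ^t* *m X *m V) l l - (V ^t* *m X *m V) o o)) *: (F U k - F U o)).
Proof.
move=> hU hV bU bV bk bl cr ht.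
have t0 : 0 <= t by apply: le_trans ht; rewrite mulr_ge0.
have [->|lo] := eqVneq l o.
  apply: dephasing_cone_ext (block_depolarizing_cone t0) => X.
  by rewrite subrr mulr0 scale0r addr0.
(* Products act from left to right: for k != o, s1 sends l to k and fixes o, whereas s2 sends l to o
   and o to k. *)
pose s1 := tperm l k; pose s2 := (s1 * tperm o k)%g.
have hs1 : s1 \in G by apply/block_permsP; apply: tperm_block; rewrite bk.
have hs2 : s2 \in G.
  apply/block_permsP => m; rewrite permM tperm_block ?bk //.
  by move/block_permsP: hs1.
apply: dephasing_cone_ext (perm_dephasing_perturb hU hV bU bV hs1 hs2 cr ht) => X.
congr (_ + _); rewrite -scalerA; congr (_ *: _).
rewrite /perm_dephasing -sumrB (bigD1 l) // (bigD1 o) 1?eq_sym //= big1 => [|m].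
  rewrite addr0 /s2 !permM /s1 tpermL tpermR.
  have [->|ko] := eqVneq k o.
    by rewrite tpermR tperm1 !perm1 !subrr scaler0 addr0.
  have -> : tperm l k o = o by rewrite tpermD.
  rewrite tpermL scalerBl -!scalerBr; congr (_ + _).
  by rewrite -scalerN opprB.
move=> /andP[ml mo]; rewrite /s2 permM.
suff -> : tperm o k (s1 m) = s1 m by rewrite subrr.
have [ko|ko] := eqVneq k o; first by rewrite ko tperm1 perm1.
rewrite tpermD //.
  rewrite eq_sym /s1; case: tpermP => [e|_|_ _] //.
by rewrite -(tpermL l k) (inj_eq perm_inj) eq_sym.
Qed.

(** Since the eigenvalues of A and of B sum to zero, A is the sum of the a_k (F_k - F_o) and tr (B
    X) that of the c_l (x_l - x_o). Each of the d * d products is a swap, paid for by its own share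
    t' of Omega. *)
Lemma dephasing_cone_rank1 o A B t : A ^t* = A -> B ^t* = B ->
  block_supported o A -> block_supported o B -> \tr A = 0 -> \tr B = 0 ->
  entry_norm A * entry_norm B * #|G|%:R *+ (d * d) <= t ->
  dephasing_cone (fun X => t *: block_depolarizing b X + \tr (B *m X) *: A).
Proof.
move=> hA hB sA sB tA tB ht.
have [U [a [hU bU eA [ar a0 sa] na]]] := hermitian_supported_diag hA sA tA.
have [V [c [hV bV eB [cr c0 sc] nc]]] := hermitian_supported_diag hB sB tB.
pose t' := entry_norm A * entry_norm B * #|G|%:R.
have t'0 : 0 <= t' by rewrite !mulr_ge0 ?entry_norm_ge0.
pose x X l := (V ^t* *m X *m V) l l.
apply: (dephasing_cone_ext (Psi := fun X =>
   (t - t' *+ (d * d)) *: block_depolarizing b X +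
   \sum_k \sum_l (t' *: block_depolarizing b X +
      (a k * c l * (x X l - x X o)) *: (F U k - F U o)))).
  move=> X; under [in RHS]eq_bigr do rewrite big_split /= sumr_const card_ord.
  rewrite big_split /= sumr_const card_ord addrA -mulrnA scalerMnl -scalerDl.
  rewrite subrK; congr (_ + _).
  have -> : \tr (B *m X) = \sum_l c l * (x X l - x X o).
    rewrite eB mulmx_suml linear_sum /=.
    under [RHS]eq_bigr do rewrite mulrBr.
    rewrite sumrB -mulr_suml sc mul0r subr0; apply: eq_bigr => l _.
    by rewrite -scalemxAl linearZ /= delta_conj_trace.
  have -> : A = \sum_k a k *: (F U k - F U o).
    under [RHS]eq_bigr do rewrite scalerBr.
    by rewrite sumrB -scaler_suml sa scale0r subr0.
  rewrite scaler_sumr; apply: eq_bigr => k _.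
  rewrite scaler_suml; apply: eq_bigr => l _; rewrite scalerA; congr (_ *: _); ring.
apply: dephasing_coneD.
  by apply: block_depolarizing_cone; rewrite subr_ge0.
apply: dephasing_cone_sum => k _; apply: dephasing_cone_sum => l _.
have [bk|bk] := eqVneq (b k) (b o); last first.
  apply: dephasing_cone_ext (block_depolarizing_cone t'0) => X.
  by rewrite a0 // !mul0r scale0r addr0.
have [bl|bl] := eqVneq (b l) (b o); last first.
  apply: dephasing_cone_ext (block_depolarizing_cone t'0) => X.
  by rewrite c0 // mulr0 mul0r scale0r addr0.
apply: dephasing_cone_swap => //; first exact: rpredM.
by rewrite normrM ler_wpM2r // ler_pM.
Qed.

End NearDepolarizing.

(** * A self-dual Hermitian frame for the trace pairing *)

Section HermitianFrame.
Local Open Scope sesquilinear_scope.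
Variables (C : numClosedFieldType) (d : nat).

(** The real and, up to sign, imaginary parts of all matrix units. The family is redundant, and the
    factor 1/2 makes it its own dual. *)
Definition hermitian_frame (t : 'I_d * 'I_d * bool) : 'M[C]_d :=
  if t.2 then 2^-1 *: (delta_mx t.1.1 t.1.2 + delta_mx t.1.2 t.1.1)
  else ('i / 2) *: (delta_mx t.1.1 t.1.2 - delta_mx t.1.2 t.1.1).

Lemma hermitian_frame_dag t : (hermitian_frame t) ^t* = hermitian_frame t.
Proof.
rewrite /hermitian_frame; case: ifP => _.
  by rewrite dagZ dagD !dag_delta addrC fmorphV rmorph_nat.
rewrite dagZ dagB !dag_delta rmorphM /= conjCi fmorphV rmorph_nat.
by rewrite -opprB scalerN mulNr scaleNr opprK.
Qed.

Lemma mxtrace_delta_mul (X : 'M[C]_d) k l : \tr (delta_mx k l *m X) = X l k.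
Proof.
rewrite -(mul_delta_mx (0 : 'I_1)) -mulmxA mxtrace_mulC -rowE -colE.
by rewrite /mxtrace big_ord1 !mxE.
Qed.

Lemma hermitian_frame_sum (X : 'M[C]_d) :
  X = \sum_t \tr (hermitian_frame t *m X) *: hermitian_frame t.
Proof.
rewrite -(pair_bigA _ (fun kl e => \tr (hermitian_frame (kl, e) *m X) *:
  hermitian_frame (kl, e))) /=.
have e kl : \sum_(e : bool) \tr (hermitian_frame (kl, e) *m X) *:
    hermitian_frame (kl, e) = 2^-1 *: (X kl.2 kl.1 *: delta_mx kl.2 kl.1 +
      X kl.1 kl.2 *: delta_mx kl.1 kl.2).
  rewrite (bigD1 true) //= (bigD1 false) //= big1 ?addr0; last by case.
  rewrite /hermitian_frame /= -!scalemxAl !mxtraceZ mulmxDl mulmxBl.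
  rewrite mxtraceD [\tr (_ - _)]linearB /= !mxtrace_delta_mul.
  move: (delta_mx kl.1 kl.2) (delta_mx kl.2 kl.1) => A B.
  apply/matrixP => i j; rewrite !mxE.
  have i2 : 'i * 'i = -1 :> C by rewrite -expr2 sqrCi.
  have -> : forall x y a c : C, 'i / 2 * (x - y) * ('i / 2 * (a - c)) =
      ('i * 'i) * (2^-1 * (x - y) * (2^-1 * (a - c))) by move=> *; ring.
  by rewrite i2; field.
under eq_bigr do rewrite e.
rewrite -scaler_sumr big_split /=.
rewrite -(pair_bigA _ (fun k l => X l k *: delta_mx l k)) /= exchange_big /=.
rewrite -(pair_bigA _ (fun k l => X k l *: delta_mx k l)) /= -matrix_sum_delta.
by rewrite -mulr2n -scaler_nat scalerA mulVf ?scale1r // pnatr_eq0.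
Qed.

End HermitianFrame.

(** * A neighbourhood of the block-depolarizing map *)

Section Depolarizing.
Local Open Scope sesquilinear_scope.
Variables (C : numClosedFieldType) (d : nat) (b : 'I_d -> 'I_d).
Local Notation p := (block_proj C b).
Local Notation omega := (block_depolarizing b).
Implicit Types A X : 'M[C]_d.

Lemma block_depolarizing_is_linear : linear (omega : 'M[C]_d -> 'M[C]_d).
Proof.
move=> a X Y; apply/matrixP => i j.
rewrite [RHS]mxE [X in _ = X + _]mxE !block_depolarizingE.
rewrite mulmxDr -scalemxAr linearD linearZ /=; ring.
Qed.

HB.instance Definition _ := GRing.isLinear.Build C 'M[C]_d 'M[C]_d *:%R omega
  block_depolarizing_is_linear.

Lemma block_depolarizing_sum X :
  omega X = \sum_l (X l l / block_size C b l) *: p (b l).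
Proof.
apply/matrixP => i j; rewrite block_depolarizingE summxE mxtrace_block_proj.
rewrite mulr_suml mulr_suml big_mkcond; apply: eq_bigr => l _.
rewrite [RHS]mxE block_projE [b i == b l]eq_sym.
case: eqP => [e|_]; rewrite ?andbF ?mulr0 // andbT.
by rewrite (block_size_eq _ e).
Qed.

Lemma mxtrace_block_depolarizing A X : \tr (A *m omega X) =
  \sum_k A k k * (\tr (p (b k) *m X) / block_size C b k).
Proof.
apply: eq_bigr => k _; rewrite mxE (bigD1 k) //= big1 ?addr0.
  by rewrite block_depolarizingE eqxx mulr1.
by move=> j jk; rewrite block_depolarizingE (negPf jk) !mulr0.
Qed.

Lemma block_depolarizing_adj A X : \tr (omega A *m X) = \tr (A *m omega X).
Proof.
rewrite mxtrace_block_depolarizing block_depolarizing_sum mulmx_suml linear_sum.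
apply: eq_bigr => l _; rewrite /= -scalemxAl linearZ /=; ring.
Qed.

Lemma block_depolarizing_id X : is_diag_mx X ->
  (forall i j, b i = b j -> X i i = X j j) -> omega X = X.
Proof.
move=> /is_diag_mxP hd hc; apply/matrixP => i j; rewrite block_depolarizingE.
have [<-|ij] := eqVneq i j; last by rewrite hd ?mulr0.
rewrite mulr1 mxtrace_block_proj (eq_bigr (fun=> X i i)) => [|l /eqP/hc //].
rewrite sumr_const -mulr_natr mulfK //.
exact: lt0r_neq0 (block_size_gt0 _ _ _).
Qed.

Lemma block_depolarizing_idem X : omega (omega X) = omega X.
Proof.
apply: block_depolarizing_id => [|i j ij].
  apply/is_diag_mxP => i j; rewrite block_depolarizingE => /negPf ij.
  by rewrite -val_eqE /= ij mulr0.
by rewrite !block_depolarizingE !eqxx ij (block_size_eq _ ij).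
Qed.

Lemma mxtrace_depolarizing X : \tr (omega X) = \tr X.
Proof.
rewrite -[omega X]mul1mx -block_depolarizing_adj block_depolarizing_id ?mul1mx //.
by move=> i j _; rewrite !mxE !eqxx.
Qed.

Lemma block_depolarizing_dag A : A ^t* = A -> (omega A) ^t* = omega A.
Proof.
move=> hA; apply/matrixP => i j; rewrite dagE !block_depolarizingE eq_sym.
have [->|_] := eqVneq i j; last by rewrite !mulr0 conjC0.
rewrite !mulr1 fmorph_div /= conjC_nat; congr (_ / _).
by rewrite -mxtrace_dag dagM hA block_proj_dag mxtrace_mulC.
Qed.

Lemma block_supportedP o A : block_supported b o A <->
  A = p (b o) *m A *m p (b o).
Proof.
split=> [h|-> i j]; first apply/matrixP => i j.
  rewrite mul_proj_block mul_block_proj.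
  have [bi|bi] := eqVneq (b i); last by rewrite h ?mulr0 //; left.
  have [bj|bj] := eqVneq (b j); last by rewrite h ?mulr0 //; right.
  by rewrite !mul1r.
by rewrite mul_proj_block mul_block_proj; case=> /negPf ->; rewrite ?mul0r ?mulr0.
Qed.

(** [Phi] fixes the range of Omega, so [Phi] X is Omega X plus the sum of the tr (F_t X) Phi (F_t).
    Omega is cut into N equal shares, one per frame element, and each share absorbs one rank-one
    term. *)
Lemma dephasing_cone_near (Phi : {linear 'M[C]_d -> 'M[C]_d}) : (0 < d)%N ->
  (forall X, Phi (X ^t*) = (Phi X) ^t*) ->
  (forall X, \tr (Phi X) = \tr X) ->
  (forall c, Phi (p c) = p c) ->
  (forall c c' X, Phi (p c *m X *m p c') = p c *m Phi X *m p c') ->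
  (forall c c' X, c != c' -> Phi (p c *m X *m p c') = 0) ->
  (forall t, let A := hermitian_frame C t - omega (hermitian_frame C t) in
    entry_norm (Phi A) * entry_norm A * #|block_perms b|%:R *+ (d * d)
      <= #|{: 'I_d * 'I_d * bool}|%:R^-1) ->
  dephasing_cone Phi.
Proof.
move=> d0 hdag htr hp hbi hoff hsmall.
pose N : C := #|{: 'I_d * 'I_d * bool}|%:R.
have N0 : N != 0.
  rewrite pnatr_eq0 -lt0n; apply/card_gt0P.
  by exists (Ordinal d0, Ordinal d0, true).
pose F t := hermitian_frame C t - omega (hermitian_frame C t).
have PhiO X : Phi (omega X) = omega X.
  rewrite block_depolarizing_sum linear_sum; apply: eq_bigr => l _.
  by rewrite linearZ /= hp.
(* 1 - Omega is idempotent and self-adjoint for the trace pairing, so in the frame expansion it acts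
   on both the coefficients and the frame. *)
have eX X : X - omega X = \sum_t \tr (F t *m X) *: F t.
  have -> : X - omega X = (X - omega X) - omega (X - omega X).
    by rewrite linearB /= block_depolarizing_idem subrr subr0.
  rewrite {1 2}[X - omega X]hermitian_frame_sum linear_sum -sumrB.
  apply: eq_bigr => t _; rewrite linearZ -scalerBr /=; congr (_ *: _).
  by rewrite mulmxBr mulmxBl !linearB /= block_depolarizing_adj.
apply: (dephasing_cone_ext (Psi := fun X =>
    \sum_t (N^-1 *: omega X + \tr (F t *m X) *: Phi (F t)))).
  move=> X; rewrite big_split /= sumr_const -scaler_nat scalerA mulfV // scale1r.
  rewrite -{1}[X](subrK (omega X)) linearD /= PhiO addrC; congr (_ + _).
  by rewrite eX linear_sum; apply: eq_bigr => t _; rewrite linearZ.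
apply: dephasing_cone_sum => -[[k l] e] _; set t := (k, l, e).
(* A frame element joining two blocks is killed by [Phi]; otherwise F_t lives in the single block of
   k. *)
have [kl|kl] := eqVneq (b k) (b l); last first.
  have offd m n : delta_mx m n = p (b m) *m delta_mx m n *m p (b n) :> 'M[C]_d.
    apply/matrixP => i j; rewrite mul_proj_block mul_block_proj mxE.
    by case: (i =P m) => [->|]; case: (j =P n) => [->|]; rewrite ?eqxx ?mulr0 ?mulr1.
  have h1 : Phi (delta_mx k l) = 0 by rewrite offd hoff.
  have h2 : Phi (delta_mx l k) = 0 by rewrite offd hoff // eq_sym.
  have kl' : k != l by apply: contraNneq kl => ->.
  have z m n : m != n -> omega (delta_mx m n : 'M[C]_d) = 0.
    move=> mn; rewrite block_depolarizing_sum big1 // => i _; rewrite mxE.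
    by case: eqP => [->|_]; rewrite ?(negPf mn) ?andbF mul0r scale0r.
  have z1 := z _ _ kl'; have z2 : omega (delta_mx l k : 'M[C]_d) = 0.
    by apply: z; rewrite eq_sym.
  have e0 : Phi (F t) = 0.
    rewrite /F linearB /= PhiO /hermitian_frame; case: (t.2) => /=.
      by rewrite !linearZ !linearD /= h1 h2 z1 z2 !(scaler0, addr0, subr0, oppr0).
    by rewrite !linearZ !linearB /= h1 h2 z1 z2 !(scaler0, addr0, subr0, oppr0).
  apply: dephasing_cone_ext (block_depolarizing_cone b (_ : 0 <= N^-1)) => [X|].
    by rewrite e0 scaler0 addr0.
  by rewrite invr_ge0 ler0n.
have sF : block_supported b k (F t).
  move=> i j hij; rewrite /F mxE [X in _ + X]mxE block_depolarizingE.
  have hd m n : b m = b k -> b n = b k -> (delta_mx m n : 'M[C]_d) i j = 0.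
    move=> bm bn; rewrite mxE; case: eqP => [im|//]; case: eqP => [jn|//] /=.
    by case: hij; rewrite ?im ?jn ?bm ?bn eqxx.
  have hf : hermitian_frame C t i j = 0.
    by rewrite /hermitian_frame; case: ifP => _; rewrite !mxE;
      have := hd k l erefl (esym kl); have := hd l k (esym kl) erefl;
      rewrite !mxE => -> ->; rewrite ?addr0 ?subr0 mulr0.
  rewrite hf sub0r; have [ij|] := eqVneq i j; last by rewrite mulr0 oppr0.
  subst j; have bik : b i != b k by case: hij.
  rewrite mxtrace_block_proj big1 ?mul0r ?oppr0 // => m /eqP bm.
  have ne x : b x = b k -> m != x.
    by move=> bx; apply: contraNneq bik => e'; rewrite -bm e' bx.
  rewrite /hermitian_frame; case: ifP => _; rewrite !mxE /=.
    by rewrite (negPf (ne k erefl)) (negPf (ne l (esym kl))) addr0 mulr0.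
  by rewrite (negPf (ne k erefl)) (negPf (ne l (esym kl))) subr0 mulr0.
have hF : (F t) ^t* = F t.
  rewrite /F dagB block_depolarizing_dag hermitian_frame_dag //.
apply: (@dephasing_cone_rank1 _ _ b k) => //.
- by rewrite -hdag hF.
- by apply/block_supportedP; rewrite -hbi -(proj1 (block_supportedP k _) sF).
- by rewrite htr /F linearB /= mxtrace_depolarizing subrr.
- by rewrite /F linearB /= mxtrace_depolarizing subrr.
exact: hsmall.
Qed.

End Depolarizing.

(** * Asymptotics of the channel *)

Section Conjugation.
Local Open Scope sesquilinear_scope.
Variables (C : numClosedFieldType) (d : nat).

Lemma entry_norm_perm (A : 'M[C]_d) (w : 'S_d) :
  entry_norm (perm_mx w *m A *m (perm_mx w) ^t*) = entry_norm A.
Proof.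
rewrite /entry_norm [RHS](reindex_inj (@perm_inj _ w)); apply: eq_bigr => i _.
rewrite [RHS](reindex_inj (@perm_inj _ w)); apply: eq_bigr => j _.
by rewrite perm_conj.
Qed.

Lemma dephasing_cone_conj (W Z : 'M[C]_d) Phi :
  W \is unitarymx -> Z \is unitarymx -> dephasing_cone Phi ->
  dephasing_cone (fun X => W *m Phi (Z *m X *m Z ^t*) *m W ^t*).
Proof.
move=> hW hZ [ts [h1 h2]].
exists [seq (t.1, (W *m t.2.1, Z ^t* *m t.2.2)) | t <- ts]; split.
  move=> _ /mapP[t /h1[t0 hU hV] ->] /=; split=> //.
    by rewrite mul_unitarymx.
  by rewrite mul_unitarymx // trmxC_unitary.
move=> X; rewrite h2 mulmx_sumr mulmx_suml big_map; apply: eq_bigr => t _ /=.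
rewrite -scalemxAr -scalemxAl; congr (_ *: _).
by rewrite /twisted_dephasing /= /Ad !(dagM, trmxCK) !mulmxA.
Qed.

(** Every twisted dephasing channel sends 1 to a matrix of trace d, so evaluating at 1 shows that
    the weights sum to 1. *)
Lemma dephasing_cone_MTD (Phi : 'M[C]_d -> 'M[C]_d) : (0 < d)%N ->
  \tr (Phi 1%:M) = d%:R -> dephasing_cone Phi -> mixed_twisted_dephasing Phi.
Proof.
move=> d0 htr [ts [h1 h2]]; pose t0 : C * ('M[C]_d * 'M[C]_d) := (0, (0, 0)).
pose t (i : 'I_(size ts)) := nth t0 ts i.
have ht i : t i \in ts by rewrite mem_nth.
exists (size ts), (fun i => (t i).1), (fun i => (t i).2.1), (fun i => (t i).2.2).
have hPhi X : Phi X = \sum_i (t i).1 *: twisted_dephasing (t i).2.1 (t i).2.2 X.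
  by rewrite h2 (big_nth t0) big_mkord.
split=> // [i||i|i]; try by case: (h1 _ (ht i)).
have trd i : \tr (twisted_dephasing (t i).2.1 (t i).2.2 1%:M) = d%:R.
  have [_ hU hV] := h1 _ (ht i).
  rewrite twisted_dephasingE linear_sum /= (eq_bigr (fun=> 1)).
    by rewrite sumr_const card_ord.
  move=> j _; rewrite linearZ /= mxtrace_mulC mulmxA (unitarymx_dagl hU) mul1mx.
  rewrite -AdE /Ad trmxCK mulmx1 (unitarymx_dagl hV) mxE eqxx mul1r.
  by rewrite -[delta_mx j j]mulmx1 mxtrace_delta_mul mxE eqxx.
have dn : d%:R != 0 :> C by rewrite pnatr_eq0 -lt0n.
apply: (mulIf dn); rewrite mul1r -{2}htr hPhi linear_sum mulr_suml.
by apply: eq_bigr => i _; rewrite linearZ /= trd.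
Qed.

Definition conjugate_map (Q : 'M[C]_d) (f : 'M[C]_d -> 'M[C]_d) X :=
  Q *m f (Q ^t* *m X *m Q) *m Q ^t*.

Lemma conjugate_map_is_linear Q (f : {linear 'M[C]_d -> 'M[C]_d}) :
  linear (conjugate_map Q f).
Proof.
move=> a X Y; rewrite /conjugate_map mulmxDr mulmxDl -scalemxAr -scalemxAl.
by rewrite linearP mulmxDr mulmxDl -scalemxAr -scalemxAl.
Qed.

HB.instance Definition _ Q (f : {linear 'M[C]_d -> 'M[C]_d}) :=
  GRing.isLinear.Build C 'M[C]_d 'M[C]_d *:%R (conjugate_map Q f)
    (conjugate_map_is_linear Q f).

Section Unitary.
Local Open Scope sesquilinear_scope.
Variables (Q : 'M[C]_d) (f : {linear 'M[C]_d -> 'M[C]_d}).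
Hypothesis hQ : Q \is unitarymx.
Local Notation g := (conjugate_map Q f).
Let Qs : Q ^t* *m Q = 1%:M := unitarymx_dagl hQ.
Let sQ : Q *m Q ^t* = 1%:M := unitarymxP hQ.

Lemma conjugate_mapK X : Q ^t* *m g X *m Q = f (Q ^t* *m X *m Q).
Proof. by rewrite /conjugate_map !mulmxA Qs mul1mx -mulmxA Qs mulmx1. Qed.

Lemma unitary_conjK X : Q *m (Q ^t* *m X *m Q) *m Q ^t* = X.
Proof. by rewrite !mulmxA sQ mul1mx -mulmxA sQ mulmx1. Qed.

Lemma iter_conjugate_map n X : Q ^t* *m iter n g X *m Q =
  iter n f (Q ^t* *m X *m Q).
Proof. by elim: n => //= n <-; rewrite conjugate_mapK. Qed.

Lemma conjugate_schwarz : schwarz_map f -> schwarz_map g.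
Proof.
move=> h A; have [h1 h2] := h (Q ^t* *m A *m Q).
have e1 : g (A ^t*) = (g A) ^t*.
  by rewrite /conjugate_map !(dagM, trmxCK) mulmxA -h1 !(dagM, trmxCK) mulmxA.
split=> //; have := psdmx_congr (Q ^t*) h2; rewrite trmxCK.
congr psdmx; rewrite mulmxBr mulmxBl; congr (_ - _).
  rewrite /conjugate_map; congr (_ *m f _ *m _).
  by rewrite !(dagM, trmxCK) !mulmxA -[_ *m Q *m Q ^t*]mulmxA sQ mulmx1.
rewrite /conjugate_map !(dagM, trmxCK) !mulmxA.
by rewrite -[_ *m Q ^t* *m Q in RHS]mulmxA Qs mulmx1.
Qed.

Lemma conjugate_trace_preserving : trace_preserving f -> trace_preserving g.
Proof.
move=> h X; rewrite /conjugate_map mxtrace_mulC mulmxA Qs mul1mx h.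
by rewrite -mulmxA mxtrace_mulC -mulmxA sQ mulmx1.
Qed.

Lemma conjugate_unital : unital f -> unital g.
Proof. by move=> h; rewrite /unital /conjugate_map mulmx1 Qs h mulmx1 sQ. Qed.

Lemma conjugate_eigen r X : g X = r *: X ->
  f (Q ^t* *m X *m Q) = r *: (Q ^t* *m X *m Q).
Proof. by rewrite -conjugate_mapK => ->; rewrite -scalemxAr -scalemxAl. Qed.

End Unitary.
End Conjugation.

(** * Channels whose peripheral eigenvectors are diagonal *)

Section DiagonalPeripheral.
Local Open Scope sesquilinear_scope.
Variables (C : numClosedFieldType) (d : nat) (tau : {linear 'M[C]_d -> 'M[C]_d}).
Hypotheses (hS : schwarz_map tau) (hT : trace_preserving tau) (h1 : unital tau).
Hypothesis hcomm : forall (r : C) X Y, r != 0 -> tau X = r *: X ->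
  peripheral tau Y -> X *m Y = Y *m X.
Hypothesis hdiag : forall Y, peripheral tau Y -> is_diag_mx Y.

(** Indices not separated by any peripheral eigenvector are equivalent. The label is a
    representative chosen from the class; the default k is never reached, by reflexivity. *)
Lemma peripheral_blocks : exists b : 'I_d -> 'I_d,
  forall k l, b k = b l <-> forall Y, peripheral tau Y -> Y k k = Y l l.
Proof.
pose R k l := `[< forall Y, peripheral tau Y -> Y k k = Y l l >].
have Rrefl k : R k k by apply/asboolP.
have Rsym k l : R k l -> R l k.
  by move=> /asboolP h; apply/asboolP => Y hY; rewrite h.
have Rtrans k l m : R k l -> R l m -> R k m.
  by move=> /asboolP h /asboolP h'; apply/asboolP => Y hY; rewrite h ?h'.
exists (fun k => odflt k [pick l | R k l]) => k l; split=> [|h].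
  case: pickP => [m km|/(_ k)]; last by rewrite Rrefl.
  case: pickP => [m' lm'|/(_ l)]; last by rewrite Rrefl.
  move=> /= e; subst m'; exact/asboolP/(Rtrans _ _ _ km)/Rsym.
have kl : R k l by apply/asboolP.
have e : R k =1 R l.
  by move=> m; apply/idP/idP; apply: Rtrans => //; exact: Rsym.
rewrite (eq_pick e); case: pickP => // /(_ l); by rewrite Rrefl.
Qed.

Variable M : nat.
Hypothesis hM : forall m, (M <= m)%N ->
  forall X Y, peripheral tau Y -> iter m tau X *m Y = Y *m iter m tau X.

(* The properties of the algebra generated by the peripheral eigenvectors that
   are needed of its minimal projections. *)
Definition asymptotically_central X := [/\
  forall n Z, iter n tau (X *m Z) = iter n tau X *m iter n tau Z,
  forall n Z, iter n tau (Z *m X) = iter n tau Z *m iter n tau X,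
  forall n, is_diag_mx (iter n tau X) &
  forall m, (M <= m)%N -> forall Z,
    iter m tau Z *m iter m tau X = iter m tau X *m iter m tau Z].

Lemma asymptotically_central_peripheral Y :
  peripheral tau Y -> asymptotically_central Y.
Proof.
move=> hY; split=> [n Z|n Z|n|m hm Z].
- exact: iter_peripheral_mull.
- exact: iter_peripheral_mulr.
- exact/hdiag/peripheral_iter.
- by apply: hM => //; apply: peripheral_iter.
Qed.

Lemma asymptotically_central1 : asymptotically_central 1%:M.
Proof.
apply: asymptotically_central_peripheral; exists 1.
by rewrite normr1 scale1r; split.
Qed.

Lemma asymptotically_centralP a X Y :
  asymptotically_central X -> asymptotically_central Y ->
  asymptotically_central (a *: X + Y).
Proof.
move=> [x1 x2 x3 x4] [y1 y2 y3 y4]; split=> [n Z|n Z|n|m hm Z].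
- by rewrite mulmxDl -scalemxAl !(linearP (iter n tau)) /= x1 y1 mulmxDl -scalemxAl.
- by rewrite mulmxDr -scalemxAr !(linearP (iter n tau)) /= x2 y2 mulmxDr -scalemxAr.
- rewrite (linearP (iter n tau)) /=; apply/is_diag_mxP => i j ij; rewrite !mxE.
  by rewrite (is_diag_mxP (x3 n)) // (is_diag_mxP (y3 n)) // mulr0 addr0.
- rewrite (linearP (iter m tau)) /= mulmxDl mulmxDr -scalemxAl -scalemxAr.
  by rewrite x4 ?y4.
Qed.

Lemma asymptotically_central0 : asymptotically_central 0.
Proof.
have -> : 0 = (-1) *: 1%:M + 1%:M :> 'M[C]_d by rewrite scaleN1r addNr.
by apply: asymptotically_centralP; apply: asymptotically_central1.
Qed.

Lemma asymptotically_centralM X Y :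
  asymptotically_central X -> asymptotically_central Y ->
  asymptotically_central (X *m Y).
Proof.
move=> [x1 x2 x3 x4] [y1 y2 y3 y4]; split=> [n Z|n Z|n|m hm Z].
- by rewrite -mulmxA !x1 y1 mulmxA.
- by rewrite mulmxA y2 x2 x1 mulmxA.
- rewrite x1; apply/is_diag_mxP => i j ij; rewrite mxE big1 // => k _.
  have [e|ik] := eqVneq (i : nat) k; last by rewrite (is_diag_mxP (x3 n)) ?mul0r.
  by rewrite (is_diag_mxP (y3 n)) ?mulr0 // -e.
- by rewrite x1 mulmxA x4 // -!mulmxA y4.
Qed.

Variable b : 'I_d -> 'I_d.
Hypothesis hb :
  forall k l, b k = b l <-> forall Y, peripheral tau Y -> Y k k = Y l l.
Local Notation p := (block_proj C b).

(** Interpolation: p_c is a product of factors (Y - Y_ll) / (Y_kk - Y_ll), one for each l outside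
    the block of k, where Y is a peripheral eigenvector separating k from l. *)
Lemma block_proj_asymptotically_central c : asymptotically_central (p c).
Proof.
have [k bk|none] := pickP (fun k => b k == c); last first.
  have -> : p c = 0.
    by apply/matrixP => i j; rewrite block_projE none andbF mxE.
  exact: asymptotically_central0.
have sep (s : seq 'I_d) : all (fun l => b l != c) s ->
  exists A, [/\ asymptotically_central A, is_diag_mx A, A k k = 1,
    forall l, l \in s -> A l l = 0 & forall i j, b i = b j -> A i i = A j j].
  elim: s => [|l s IH] /= => [_|/andP[lc /IH[A [a1 a2 a3 a4 a5]]]].
    exists 1%:M; split=> //; first exact: asymptotically_central1.
    - by rewrite mxE eqxx.
    - by move=> i j _; rewrite !mxE !eqxx.
  have [Y hY ne] : exists2 Y, peripheral tau Y & Y l l != Y k k.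
    apply: contrapT => h; move/eqP: lc; apply; rewrite -(eqP bk).
    apply/hb => Y hY; apply: contrapT => /eqP ne; apply: h; by exists Y.
  have yd := hdiag hY.
  have ne' : Y k k - Y l l != 0 by rewrite subr_eq0 eq_sym.
  (* B is 1 at k and 0 at l; the trailing 0 gives it the shape required by
     [asymptotically_centralP]. *)
  pose B := (Y k k - Y l l)^-1 *: Y + ((- Y l l / (Y k k - Y l l)) *: 1%:M + 0).
  have BE i : B i i = (Y i i - Y l l) / (Y k k - Y l l).
    by rewrite !mxE eqxx addr0 mulr1n mulr1; field.
  have Bc : asymptotically_central B.
    apply: asymptotically_centralP; first exact: asymptotically_central_peripheral.
    apply: asymptotically_centralP; first exact: asymptotically_central1.
    exact: asymptotically_central0.
  have ABc := asymptotically_centralM a1 Bc.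
  have ABE i : (A *m B) i i = A i i * B i i.
    rewrite mxE (bigD1 i) //= big1 ?addr0 // => j ji.
    by rewrite (is_diag_mxP a2) ?mul0r // val_eqE eq_sym.
  exists (A *m B); split=> //.
  - by case: ABc => _ _ /(_ 0%N).
  - by rewrite ABE BE a3 mul1r divff.
  - move=> i; rewrite inE ABE BE => /predU1P[->|/a4 ->]; last by rewrite mul0r.
    by rewrite subrr mul0r mulr0.
  - move=> i j ij; rewrite !ABE !BE (a5 _ _ ij).
    by have /hb/(_ Y hY) -> := ij.
have [|A [a1 a2 a3 a4 a5]] := sep (filter (fun l => b l != c) (enum 'I_d)).
  exact: filter_all.
suff -> : p c = A by [].
apply/matrixP => i j; rewrite block_projE.
have [<-|ij] /= := eqVneq i j; last by rewrite (is_diag_mxP a2).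
have [bi|bi] := eqVneq (b i) c; last by rewrite a4 // mem_filter bi mem_enum.
by rewrite (a5 i k) ?a3 // bi (eqP bk).
Qed.

(** By multiplicativity and trace preservation, the tau^n (p_c) are diagonal idempotents with sum 1
    and the traces of the p_c. The permutation may depend on n. *)
Lemma iter_relabel n : exists w : 'S_d, forall c,
  perm_mx w *m iter n tau (p c) *m (perm_mx w) ^t* = p c.
Proof.
apply: block_proj_relabel => [c|c||c].
- by case: (block_proj_asymptotically_central c).
- have [<- _ _ _] := block_proj_asymptotically_central c.
  by rewrite block_proj_mul eqxx scale1r.
- by rewrite -(linear_sum (iter n tau)) block_proj_sum; apply: iter_unital.
- exact: iter_trace.
Qed.

Lemma iter_dephasing_cone n : (0 < d)%N -> (M <= n)%N ->
  (forall t,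
    let A := hermitian_frame C t -
      block_depolarizing b (hermitian_frame C t) in
    entry_norm (iter n tau A) * entry_norm A * #|block_perms b|%:R *+ (d * d)
      <= #|{: 'I_d * 'I_d * bool}|%:R^-1) ->
  dephasing_cone (iter n tau).
Proof.
move=> d0 hn hsmall; have [w hw] := iter_relabel n.
pose P : 'M[C]_d := perm_mx w.
have hP : P \is unitarymx := perm_mx_unitary C w.
have Ps := unitarymx_dagl hP.
pose f : {linear 'M[C]_d -> 'M[C]_d} := iter n tau.
pose Phi X := P *m f X *m P ^t*.
have Phi_lin : linear Phi.
  move=> a X Y; rewrite /Phi linearP mulmxDr mulmxDl.
  by rewrite -scalemxAr -scalemxAl.
pose PhiL : {linear 'M[C]_d -> 'M[C]_d} :=
  HB.pack Phi (GRing.isLinear.Build C 'M[C]_d 'M[C]_d *:%R Phi Phi_lin).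
have pc := block_proj_asymptotically_central.
have cone : dephasing_cone PhiL.
  apply: (@dephasing_cone_near _ _ b PhiL) => //=.
  - by move=> X; rewrite /Phi /f /= iter_dag // !(dagM, trmxCK) mulmxA.
  - by move=> X; rewrite /Phi mxtrace_mulC mulmxA Ps mul1mx /f /= iter_trace.
  - move=> c c' X; rewrite /Phi /f /=.
    have [_ e2 _ _] := pc c'; have [e1 _ _ _] := pc c.
    rewrite e2 e1 -{2}(hw c) -{2}(hw c') -/P !mulmxA.
    by rewrite -2![_ *m P ^t* *m P in RHS]mulmxA !Ps !mulmx1.
  (* For n >= M, the image of p_c commutes with the output, so it meets the image of p_c', and their
     product is zero. *)
  - move=> c c' X cc; rewrite /Phi /f /=.
    have [_ e2 _ _] := pc c'; have [e1 _ _ e4] := pc c.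
    have e0 : iter n tau (p c) *m iter n tau (p c') = 0.
      by rewrite -e1 block_proj_mul (negPf cc) scale0r (linear0 (iter n tau)).
    rewrite e2 e1 -e4 // -[_ *m _ *m iter n tau (p c')]mulmxA e0.
    by rewrite !mulmx0 mul0mx.
  - by move=> t; rewrite /Phi entry_norm_perm; exact: hsmall.
apply: dephasing_cone_ext (dephasing_cone_conj (W := P ^t*) (Z := 1%:M) _ _ cone).
- move=> X; rewrite /= /Phi mul1mx dag1 mulmx1 trmxCK !mulmxA Ps mul1mx.
  by rewrite -mulmxA Ps mulmx1.
- by rewrite trmxC_unitary.
- by apply/unitarymxP; rewrite dag1 mulmx1.
Qed.

Lemma eventually_dephasing_cone : archi_powers C -> (0 < d)%N ->
  exists n0, forall n, (n0 <= n)%N -> dephasing_cone (iter n tau).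
Proof.
move=> harch d0.
pose A t := hermitian_frame C t - block_depolarizing b (hermitian_frame C t).
(* K collects the factors multiplying the norm of the iterate in the smallness condition; the added
   1 makes it invertible. *)
pose K t : C := (entry_norm (A t) + 1) * #|block_perms b|%:R * (d * d)%:R.
pose N : C := #|{: 'I_d * 'I_d * bool}|%:R.
have N0 : 0 < N.
  rewrite ltr0n; apply/card_gt0P; by exists (Ordinal d0, Ordinal d0, true).
have K0 t : 0 < K t.
  rewrite !mulr_gt0 ?block_perms_gt0 ?ltr0n ?muln_gt0 ?d0 //.
  by rewrite ltr_wpDl ?entry_norm_ge0.
have hv t : vanishes (fun k => iter k tau (A t)).
  (* A peripheral Y is diagonal and constant on blocks, hence fixed by Omega and trace-orthogonal to
     A t. *)
  apply: peripheral_orthogonal_vanishes => // Y hY.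
  rewrite mulmxBr linearB /= -block_depolarizing_adj block_depolarizing_id ?subrr //.
    exact: hdiag.
  by move=> i j /hb; apply.
have /choice[n0 hn0] : forall t, exists n, forall k, (n <= k)%N ->
    entry_norm (iter k tau (A t)) <= (N * K t)^-1.
  by move=> t; apply: vanishes_sum_norm => //; rewrite invr_gt0 mulr_gt0.
exists (maxn M (\max_t n0 t)) => n; rewrite geq_max => /andP[hMn hn].
apply: iter_dephasing_cone => // t; lazy zeta; rewrite -/(A t) -/N.
have h : entry_norm (iter n tau (A t)) <= (N * K t)^-1.
  by apply: hn0; apply: leq_trans hn; exact: leq_bigmax.
rewrite -[leLHS]mulr_natr -!mulrA.
apply: le_trans (_ : (N * K t)^-1 * K t <= _).
  apply: ler_pM => //; rewrite ?entry_norm_ge0 //.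
    by rewrite !mulr_ge0 ?entry_norm_ge0.
  by rewrite /K -[leRHS]mulrA ler_wpM2r ?mulr_ge0 // lerDl.
by rewrite invfM mulfVK // gt_eqF.
Qed.

End DiagonalPeripheral.

(** * Reduction to diagonal peripheral eigenvectors *)

Section Equivalence.
Local Open Scope sesquilinear_scope.
Variables (C : numClosedFieldType) (d : nat) (tau : {linear 'M[C]_d -> 'M[C]_d}).

Lemma commutant_peripheral X : commutant (peripheral_space tau) X <->
  forall Y, peripheral tau Y -> X *m Y = Y *m X.
Proof.
split=> [h Y hY|h _ [m [c [v [hv ->]]]]].
  apply: h; exists 1%N, (fun=> 1), (fun=> Y); split=> //.
  by rewrite big_ord1 scale1r.
rewrite mulmx_sumr mulmx_suml; apply: eq_bigr => i _.
by rewrite -scalemxAl -scalemxAr h //; apply: hv.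
Qed.

Lemma eigenkerP (r : C) X : eigenker tau r X <-> tau X = r *: X.
Proof.
rewrite /eigenker /=; split=> [/eqP|->]; last exact: subrr.
by rewrite subr_eq0 => /eqP.
Qed.

(** Peripheral eigenvalues are nonzero, so the peripheral eigenvectors commute with one another and
    with their adjoints. One unitary diagonalizes them all, and conjugating the channel by it
    preserves the hypotheses and the cone. *)
Lemma eigenvectors_commute_eventually_MTD : archi_powers C -> (0 < d)%N ->
  schwarz_map tau -> trace_preserving tau -> unital tau ->
  (forall (r : C) X Y, r != 0 -> tau X = r *: X ->
    peripheral tau Y -> X *m Y = Y *m X) ->
  eventually_has mixed_twisted_dephasing tau.
Proof.
move=> harch d0 hS hT h1 hcomm.
have nz (l : C) : `|l| = 1 -> l != 0 by move=> e; rewrite -normr_eq0 e oner_neq0.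
have [Q hQ hD] := @codiagonalization C d (peripheral tau)
  (peripheral_dag hS) (fun A B hA hB => let: ex_intro l (conj hl e) := hA in
     hcomm l A B (nz l hl) e hB).
have Qs := unitarymx_dagl hQ; have sQ := unitarymxP hQ.
pose g : {linear 'M[C]_d -> 'M[C]_d} := conjugate_map Q tau.
have gS : schwarz_map g := conjugate_schwarz hQ hS.
have gT : trace_preserving g := conjugate_trace_preserving hQ hT.
have g1 : unital g := conjugate_unital hQ h1.
have gper Y : peripheral g Y -> peripheral tau (Q ^t* *m Y *m Q).
  by move=> [l [hl e]]; exists l; split=> //; exact: conjugate_eigen.
have gcomm (r : C) X Y : r != 0 -> g X = r *: X -> peripheral g Y ->
    X *m Y = Y *m X.
  move=> r0 eX /gper hY; have := hcomm r _ _ r0 (conjugate_eigen hQ eX) hY.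
  move=> /(congr1 (fun A => Q *m A *m Q ^t*)).
  have e A B : Q *m (Q ^t* *m A *m Q *m (Q ^t* *m B *m Q)) *m Q ^t* = A *m B.
    rewrite !mulmxA sQ mul1mx -[_ *m Q *m Q ^t*]mulmxA sQ mulmx1.
    by rewrite -[_ *m Q *m Q ^t*]mulmxA sQ mulmx1.
  by rewrite !e.
have gdiag Y : peripheral g Y -> is_diag_mx Y.
  by move=> /gper/hD; rewrite unitary_conjK.
have [M hM] := iter_commute_peripheral gS gT gcomm.
have [b hb] := peripheral_blocks g.
have [n0 hn0] := eventually_dephasing_cone gS gT g1 gdiag hM hb harch d0.
exists n0 => n /hn0 cone.
apply: dephasing_cone_MTD => //; first by rewrite iter_trace // mxtrace1.
apply: dephasing_cone_ext (dephasing_cone_conj (W := Q ^t*) (Z := Q) _ _ cone) => //.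
  move=> X; rewrite trmxCK iter_conjugate_map //; congr (iter n tau _).
  by rewrite !mulmxA Qs mul1mx -mulmxA Qs mulmx1.
by rewrite trmxC_unitary.
Qed.

End Equivalence.

(** * Complex numbers over a real field, and the equivalence *)

Local Open Scope complex_scope.

(** The order on [R[i]] forces r and e to be real. Bernoulli's inequality with h = x^-1 - 1 then
    makes x^-k exceed y^-1. *)
Lemma archi_powers_complex (R : realType) : archi_powers R[i].
Proof.
have bern (h : R) k : 0 <= h -> 1 + h *+ k <= (1 + h) ^+ k.
  move=> h0; elim: k => [|k IH]; first by rewrite mulr0n addr0 expr0.
  rewrite exprS; apply: le_trans (_ : (1 + h) * (1 + h *+ k) <= _); last first.
    by rewrite ler_wpM2l // addr_ge0.
  rewrite mulrS -mulr_natr -subr_ge0.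
  have -> : (1 + h) * (1 + h * k%:R) - (1 + (h + h * k%:R)) = h * (h * k%:R) by ring.
  by rewrite !mulr_ge0.
have real (x y : R) : 0 <= x -> x < 1 -> 0 < y -> exists k, x ^+ k < y.
  move=> x0 x1 y0; have [->|xn] := eqVneq x 0; first by exists 1%N; rewrite expr1.
  have xp : 0 < x by rewrite lt_def xn.
  have h0 : 0 < x^-1 - 1 by rewrite subr_gt0 invf_gt1.
  pose k := Num.bound (y^-1 / (x^-1 - 1)); exists k.
  have hk : y^-1 < (x^-1 - 1) *+ k.
    rewrite -mulr_natr -ltr_pdivrMl // mulrC archi_boundP // divr_ge0 //.
      by rewrite invr_ge0 ltW.
    exact: ltW.
  have := bern _ k (ltW h0); rewrite (addrCA 1) subrr addr0 exprVn => hb.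
  rewrite -ltf_pV2 ?posrE ?exprn_gt0 //; apply: lt_le_trans hb.
  by apply: lt_trans hk _; rewrite ltrDr.
move=> [r r'] [e e']; rewrite lecE ltcE /= => /andP[/eqP -> r0] /andP[_ r1].
rewrite ltcE /= => /andP[/eqP -> e0].
have [k hk] := real r e r0 r1 e0; exists k.
by rewrite -[r +i* 0]/(r%:C) -[e +i* 0]/(e%:C) -rmorphXn ltcR.
Qed.

Theorem theorem6p11 (R : realType) (d : nat) (hd : (0 < d)%N)
    (tau : {linear 'M[R[i]]_d -> 'M[R[i]]_d})
    (htau : quantum_channel tau) (tau_unital : unital tau) :
  [<-> eventually_has mixed_twisted_dephasing tau;
       eventually_has entanglement_breaking tau;
       eventually_has PPT tau;
       eventually_has (copositive 2) tau;
       exists n0 : nat,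
         range (iter n0 tau) `<=` commutant (peripheral_space tau);
       \bigcap_(n in [set n : nat | (1 <= n)%N]) range (iter n tau)
         `<=` commutant (peripheral_space tau);
       forall lambda : R[i], lambda != 0 ->
         eigenker tau lambda `<=` commutant (peripheral_space tau)].
Proof.
have [hcp hT] := htau.
have hS : schwarz_map tau := two_positive_schwarz (hcp 2%N isT) tau_unital.
tfae.
- exact/eventually_has_impl/MTD_EB.
- exact/eventually_has_impl/EB_PPT.
- by apply: eventually_has_impl => phi; apply: PPT_copositive.
- move=> [n0 h]; exists n0 => _ [X _ <-]; apply/commutant_peripheral => Y hY.
  by apply: copositive_commute => //; apply: h.
(* The intersection starts at n = 1, so n0 = 0 is treated apart: every X is in the range of
   tau^0. *)
- move=> [n0 h] X hX; apply: h; case: n0 => [|n]; first by exists X.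
  exact: hX.
- move=> h l l0 X /eigenkerP eX; apply: h => n _.
  exists ((l ^+ n)^-1 *: X) => //.
  by rewrite linearZ /= (iter_eigen n eX) scalerA mulVf ?scale1r // expf_neq0.
- move=> h; apply: eigenvectors_commute_eventually_MTD => //.
    exact: archi_powers_complex.
  move=> r X Y r0 eX hY; move/eigenkerP: eX => /(h r r0)/commutant_peripheral.
  exact.
Qed.
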